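(* Let $n\geqslant 1$ be an integer, let $c,H>0$ and let $b,m^2\geqslant 0$ be such that $b^2\geqslant 4m^2$. Assume $\beta\geqslant 0$ and $p>1$ are such that $$\frac n2-\frac{\sqrt{b^2-4m^2}}{2H}\leqslant\frac1p,$$ and set $$\varrho_{\mathrm{crit}}(n,H,b,m^2,\beta,p)=\tfrac12\left(b-\sqrt{b^2-4m^2}\right)\left((\beta+1)p-1\right)+nH(\beta+1)(p-1),$$ $$\kappa_{\mathrm{crit}}(b,m^2,\beta,p)=\begin{cases}-1 & \text{if } b^2>4m^2,\\ -1-(\beta+1)p & \text{if } b^2=4m^2.\end{cases}$$ Assume $\varsigma>\kappa_{\mathrm{crit}}(b,m^2,\beta,p)$ and consider $\Gamma(t)=\mu\,\mathrm{e}^{\varrho_{\mathrm{crit}}(n,H,b,m^2,\beta,p)t}(1+t)^{\varsigma}$ for some $\mu>0$ in the nonlinear term $$f(t,v)=\Gamma(t)\left(\int_{\mathbb{R}^n}|v(t,y)|^p\,\mathrm{d}y\right)^{\beta}|v|^p .$$ Let $v_0,v_1\in L^1_{\mathrm{loc}}(\mathbb{R}^n)$ be nonnegative, nontrivial and compactly supported functions with supports contained in $B_R$ for some $R>0$. Let $v\in\mathcal{C}^1([0,T),L^1_{\mathrm{loc}}(\mathbb{R}^n))$ be a weak solution (in the sense defined in the context) to the Cauchy problem $$\begin{cases}\partial_t^2v-c^2\mathrm{e}^{2Ht}\Delta v+b\,\partial_tv+m^2v=f(t,v), & x\in\mathbb{R}^n,\ t\in(0,T),\\ v(0,x)=\varepsilon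 v_0(x), & x\in\mathbb{R}^n,\\ \partial_tv(0,x)=\varepsilon v_1(x), & x\in\mathbb{R}^n,\end{cases}$$ with lifespan $T=T(\varepsilon)$. Then there exists a positive constant $\varepsilon_0=\varepsilon_0(n,c,H,b,m^2,\beta,p,\mu,\varsigma,v_0,v_1,R)$ such that for any $\varepsilon\in(0,\varepsilon_0]$ the weak solution $v$ blows up in finite time. Furthermore, the following upper bound estimates for the lifespan hold: $$T(\varepsilon)\leqslant\begin{cases}C\,\varepsilon^{-\frac{(\beta+1)p-1}{\varsigma+1}} & \text{if } b^2>4m^2,\\[4pt] C\,\varepsilon^{-\left(\frac{\varsigma+2}{(\beta+1)p-1}+1\right)^{-1}} & \text{if } b^2=4m^2,\end{cases}$$ where the positive constant $C$ is independent of $\varepsilon$.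
   Context: Here $\varepsilon>0$ is a parameter describing the size of the initial data, $B_\rho=\{x\in\mathbb{R}^n:|x|\leqslant\rho\}$, and $T=T(\varepsilon)\in(0,\infty]$ denotes the lifespan, i.e. the maximal existence time, of the weak solution; blow-up in finite time means $T(\varepsilon)<\infty$. Definition (weak solution). Let $v_0,v_1\in L^1_{\mathrm{loc}}(\mathbb{R}^n)$ with $\operatorname{supp}v_0,\operatorname{supp}v_1\subset B_R$ for some $R>0$. A function $v\in\mathcal{C}^1([0,T),L^1_{\mathrm{loc}}(\mathbb{R}^n))$ such that $f(t,v)\in L^1_{\mathrm{loc}}((0,T)\times\mathbb{R}^n)$ is a weak solution to the Cauchy problem on $[0,T)$ if $\operatorname{supp}v(t,\cdot)\subset B_{R+cH^{-1}(\mathrm{e}^{Ht}-1)}$ for any $t\in(0,T)$ and the integral identity $$\begin{aligned}&\int_{\mathbb{R}^n}\partial_tv(t,x)\varphi(t,x)\,\mathrm{d}x-\int_{\mathbb{R}^n}v(t,x)\varphi_t(t,x)\,\mathrm{d}x+b\int_{\mathbb{R}^n}v(t,x)\varphi(t,x)\,\mathrm{d}x\\&\quad+\int_0^t\int_{\mathbb{R}^n}v(s,x)\left(\varphi_{ss}(s,x)-c^2\mathrm{e}^{2Hs}\Delta\varphi(s,x)-b\,\varphi_s(s,x)+m^2\varphi(s,x)\right)\mathrm{d}x\,\mathrm{d}s\\&=\varepsilon\int_{\mathbb{R}^n}v_1(x)\varphi(0,x)\,\mathrm{d}x+\varepsilon\int_{\mathbb{R}^n}v_0(x)\left(b\,\varphi(0,x)-\varphi_t(0,x)\right)\mathrm{d}x\\&\quad+\int_0^t\Gamma(s)\left(\int_{\mathbb{R}^n}|v(s,y)|^p\,\mathrm{d}y\right)^{\beta}\int_{\mathbb{R}^n}|v(s,x)|^p\varphi(s,x)\,\mathrm{d}x\,\mathrm{d}s\end{aligned}$$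 holds for any $t\in(0,T)$ and any test function $\varphi\in\mathcal{C}^\infty_0([0,T)\times\mathbb{R}^n)$. *)

(* Defs.v *)
From HB Require Import structures.
From mathcomp Require Import all_boot all_order all_algebra.
From mathcomp Require Import all_classical all_reals all_analysis.

Set Implicit Arguments.
Unset Strict Implicit.
Unset Printing Implicit Defensive.
Import Order.TTheory GRing.Theory Num.Theory.
Import numFieldNormedType.Exports.

Local Open Scope classical_set_scope.
Local Open Scope ring_scope.

(* 'rV[R]_n carries the sigma-algebra generated by its coordinates, as the
   library does for n.-tuple; this is the Borel sigma-algebra of R^n. *)
Section measurable_rV.
Context (R : realType) (n : nat).

Definition rV_coord (i : 'I_n) (x : 'rV[R]_n) : measurableTypeR R := x ord0 i.

Let rV_set0 : g_sigma_preimage rV_coord set0.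
Proof. exact: sigma_algebra0. Qed.

Let rV_setC A : g_sigma_preimage rV_coord A -> g_sigma_preimage rV_coord (~` A).
Proof. exact: sigma_algebraC. Qed.

Let rV_bigcup (F : _^nat) : (forall i, g_sigma_preimage rV_coord (F i)) ->
  g_sigma_preimage rV_coord (\bigcup_i (F i)).
Proof. exact: sigma_algebra_bigcup. Qed.

HB.instance Definition _ := @isMeasurable.Build default_measure_display
  'rV[R]_n (g_sigma_preimage rV_coord) rV_set0 rV_setC rV_bigcup.

End measurable_rV.

Lemma sigma_finite_product (R : realType) d1 d2 (T1 : measurableType d1)
    (T2 : measurableType d2) (m1 : {sigma_finite_measure set T1 -> \bar R})
    (m2 : {sigma_finite_measure set T2 -> \bar R}) :
  sigma_finite setT (m1 \x m2)%E.
Proof.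
have /sigma_finiteP[F [TF ndF Foo]] := sigma_finiteT m1.
have /sigma_finiteP[G [TG ndG Goo]] := sigma_finiteT m2.
exists (fun k => F k `*` G k).
  rewrite -setXTT TF TG predeqE => -[x y]; split.
    move=> [/= [k _ Fkx] [l _ Gly]]; exists (maxn k l) => //; split.
    - by move: x Fkx; exact/subsetPset/ndF/leq_maxl.
    - by move: y Gly; exact/subsetPset/ndG/leq_maxr.
  by move=> [k _ []/= ? ?]; split; exists k.
move=> k; have [? ?] := Foo k; have [? ?] := Goo k.
split; first exact: measurableX.
by rewrite product_measure1E// lte_mul_pinfty// ge0_fin_numE.
Qed.

Section lebesgue_rV.
Context (R : realType).

Lemma measurable_rV_coord n (i : 'I_n) : measurable_fun setT (@rV_coord R n i).
Proof.
move=> _ Y mY; rewrite setTI; apply: sub_sigma_algebra => /=.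
rewrite -bigcup_seq/=; exists i => /=; first by rewrite mem_index_enum.
by exists Y => //; rewrite setTI.
Qed.

Lemma measurable_fun_rV d (T : measurableType d) n (f : T -> 'rV[R]_n) :
  (forall i, measurable_fun setT (rV_coord i \o f)) -> measurable_fun setT f.
Proof.
move=> mf.
have sub : g_sigma_preimage (fun i => @rV_coord R n i \o f) `<=` measurable.
  apply: smallest_sub; first exact: sigma_algebra_measurable.
  case: n => [|n] in f mf *; first by rewrite big_ord0.
  rewrite -bigcup_mkord_ord; apply: bigcup_sub => i Ii.
  by move=> A [B mB <-]; exact: mf.
move=> _ A mA; apply: sub.
by rewrite g_sigma_preimage_comp; exists A.
Qed.

Section step.
Context (n : nat) (mu : {sigma_finite_measure set 'rV[R]_n -> \bar R}).

Definition cons_rV (ay : measurableTypeR R * 'rV[R]_n) : 'rV[R]_n.+1 :=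
  row_mx (ay.1)%:M ay.2 : 'rV[R]_(1 + n).

Lemma measurable_cons_rV : measurable_fun setT cons_rV.
Proof.
apply: measurable_fun_rV => i.
case: (@split_ordP 1 n i) => j ->.
  rewrite (_ : _ \o _ = fst); first exact: measurable_fst.
  by apply/funext => -[a y]; rewrite /= [LHS](row_mxEl a%:M y) !ord1 mxE eqxx.
rewrite (_ : _ \o _ = rV_coord j \o snd).
  by apply: measurableT_comp; [exact: measurable_rV_coord | exact: measurable_snd].
by apply/funext => -[a y]; exact: (row_mxEr a%:M y).
Qed.

Definition lebesgue_consT :=
  pushforward ((@lebesgue_measure R) \x mu)%E cons_rV.

Let lebesgue_consT0 : lebesgue_consT set0 = 0%E.
Proof. by rewrite /lebesgue_consT /pushforward preimage_set0 measure0. Qed.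

Let lebesgue_consT_ge0 A : (0 <= lebesgue_consT A)%E.
Proof. by rewrite /lebesgue_consT /pushforward measure_ge0. Qed.

Let lebesgue_consT_sigma_additive : semi_sigma_additive lebesgue_consT.
Proof.
move=> F mF tF mUF; rewrite /lebesgue_consT /pushforward preimage_bigcup.
have mpre A : measurable A -> measurable (cons_rV @^-1` A).
  by move=> mA; rewrite -[X in measurable X]setTI; exact: measurable_cons_rV.
apply: measure_semi_sigma_additive.
- by move=> k; exact: mpre.
- apply/trivIsetP => /= i j _ _ ij; rewrite -preimage_setI.
  by move/trivIsetP : tF => /(_ _ _ _ _ ij) ->//; rewrite preimage_set0.
- by rewrite -preimage_bigcup; exact: mpre.
Qed.

HB.instance Definition _ := isMeasure.Build _ _ _ lebesgue_consT
  lebesgue_consT0 lebesgue_consT_ge0 lebesgue_consT_sigma_additive.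

Definition uncons_rV (x : 'rV[R]_n.+1) : measurableTypeR R * 'rV[R]_n :=
  (lsubmx (x : 'rV[R]_(1 + n)) ord0 ord0, rsubmx (x : 'rV[R]_(1 + n))).

Lemma cons_rVK : cancel cons_rV uncons_rV.
Proof.
by case=> a y; rewrite /uncons_rV /cons_rV row_mxKl row_mxKr mxE eqxx.
Qed.

Lemma measurable_uncons_rV : measurable_fun setT uncons_rV.
Proof.
apply: measurable_fun_pair.
  rewrite (_ : (fun _ => _) = rV_coord (@lshift 1 n ord0)).
    exact: measurable_rV_coord.
  by apply/funext => x; rewrite /= /rV_coord mxE.
apply: measurable_fun_rV => i.
rewrite (_ : _ \o _ = rV_coord (@rshift 1 n i)); first exact: measurable_rV_coord.
by apply/funext => x; rewrite /= /rV_coord mxE.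
Qed.

Lemma sigma_finite_lebesgue_consT : sigma_finite setT lebesgue_consT.
Proof.
have [F FT Foo] := sigma_finite_product (@lebesgue_measure R) mu.
exists (fun k => uncons_rV @^-1` (F k)).
  by rewrite -preimage_bigcup -FT preimage_setT.
move=> k; have [mF muF] := Foo k; split.
  by rewrite -[X in measurable X]setTI; exact: measurable_uncons_rV.
rewrite /lebesgue_consT /pushforward -comp_preimage.
by rewrite (_ : uncons_rV \o cons_rV = id) //; apply/funext/cons_rVK.
Qed.

HB.instance Definition _ :=
  Measure_isSigmaFinite.Build _ _ _ lebesgue_consT sigma_finite_lebesgue_consT.

End step.

(* Lebesgue measure on R^n, as an iterated product measure; it is characterized
   by lebesgue_rV_box below. *)
Fixpoint lebesgue_rV (n : nat) : {sigma_finite_measure set 'rV[R]_n -> \bar R} :=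
  match n with
  | 0 => @dirac _ _ (0 : 'rV[R]_0) R
  | k.+1 => lebesgue_consT (lebesgue_rV k)
  end.

End lebesgue_rV.

Lemma cons_rV0 (R : realType) n (a : R) (y : 'rV[R]_n) :
  cons_rV (a, y) ord0 ord0 = a.
Proof.
have <- : @lshift 1 n ord0 = ord0 :> 'I_n.+1 by exact: val_inj.
by rewrite [LHS](row_mxEl a%:M y) mxE eqxx.
Qed.

Lemma cons_rVS (R : realType) n (a : R) (y : 'rV[R]_n) (j : 'I_n) :
  cons_rV (a, y) ord0 (lift ord0 j) = y ord0 j.
Proof.
have <- : @rshift 1 n j = lift ord0 j :> 'I_n.+1 by exact: val_inj.
exact: (row_mxEr a%:M y).
Qed.

Lemma lebesgue_rV_box (R : realType) n (A : 'I_n -> set (measurableTypeR R)) :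
  (forall i, measurable (A i)) ->
  (lebesgue_rV R n [set x | forall i, A i (x ord0 i)]
    = \prod_(i < n) lebesgue_measure (A i))%E.
Proof.
elim: n A => [|n IH] A mA.
  by rewrite big_ord0 /= diracE mem_set //= => -[].
rewrite big_ord_recl /= /lebesgue_consT /pushforward.
rewrite (_ : _ @^-1` _ = A ord0 `*`
    [set y : 'rV[R]_n | forall i, A (lift ord0 i) (y ord0 i)]); last first.
  apply/seteqP; split=> [[a y] h|[a y] [/= ha hy] i].
    by split=> [|i] /=; [have := h ord0 | have := h (lift ord0 i)];
      rewrite /= ?cons_rV0 ?cons_rVS.
  by have [j ->|->] := unliftP ord0 i; rewrite ?cons_rV0 ?cons_rVS.
rewrite product_measure1E//; first by congr (_ * _)%E; exact: (IH (fun i => A (lift ord0 i))).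
rewrite (_ : [set _ | _] = \bigcap_(i in setT) (rV_coord i @^-1` A (lift ord0 i))).
  apply: fin_bigcap_measurable => [|i _]; first exact: finite_finset.
  by rewrite -[X in measurable X]setTI; exact: measurable_rV_coord.
by apply/seteqP; split => [y h i _|y h i]; [exact: h|exact: (h i I)].
Qed.

Section function_spaces.
Context (R : realType) (n : nat).
Local Notation E := 'rV[R]_n.
Local Notation leb := (lebesgue_rV R n).

(* The norm carried by 'rV[R]_n is the sup norm, hence this definition. *)
Definition eucl_norm (x : E) : R := Num.sqrt (\sum_(i < n) x ord0 i ^+ 2).

Definition eucl_ball (rho : R) : set E := [set x | eucl_norm x <= rho].

(* Support of the almost-everywhere class of u: complement of the largest open
   set on which u vanishes almost everywhere. *)
Definition ess_supp (u : E -> R) : set E :=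
  ~` \bigcup_(U in [set U : set E |
        open U /\ {ae leb, forall x, U x -> u x = 0}]) U.

Definition L1loc (u : E -> R) : Prop :=
  forall K : set E, compact K -> leb.-integrable K (EFin \o u).

Definition time_interval (T : \bar R) : set R :=
  [set t | 0 <= t /\ (t%:E < T)%E].

(* Convergence in L^1_loc as the parameter runs along the filter F. *)
Definition cvg_L1loc (F : set_system R) (u : R -> E -> R) (w : E -> R) : Prop :=
  forall K : set E, compact K ->
    (fun s => \int[leb]_(x in K) `|u s x - w x|%:E)%E @ F --> 0%E.

Definition C0_L1loc (T : \bar R) (u : R -> E -> R) : Prop :=
  forall t, time_interval T t ->
    L1loc (u t) /\ cvg_L1loc (within (time_interval T) (nbhs t)) u (u t).

(* v belongs to C^1([0,T), L^1_loc) with time derivative dv; at t = 0 the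
   derivative is one-sided. *)
Definition C1_L1loc (T : \bar R) (v dv : R -> E -> R) : Prop :=
  [/\ C0_L1loc T v, C0_L1loc T dv &
      forall t, time_interval T t ->
        cvg_L1loc (within (time_interval T) t^')
          (fun s x => (v s x - v t x) / (s - t)) (dv t)].

(* Local integrability on (0,T) x R^n, for extended real valued functions. *)
Definition L1loc_spacetime (T : \bar R) (g : R * E -> \bar R) : Prop :=
  forall K : set (R * E), compact K ->
    K `<=` [set z | 0 < z.1 /\ (z.1%:E < T)%E] ->
    ((@lebesgue_measure R) \x leb)%E.-integrable K g.

End function_spaces.

Section test_functions.
Context (R : realType).

(* f is of class C^k: its iterated directional derivatives of order at most k
   exist everywhere and are continuous. *)
Fixpoint Ck (V : normedModType R) (k : nat) (f : V -> R) : Prop :=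
  continuous f /\
  match k with
  | 0 => True
  | j.+1 => forall v : V, (forall z, derivable f z v) /\ Ck j ('D_v f)
  end.

Definition smooth (V : normedModType R) (f : V -> R) : Prop :=
  forall k, Ck k f.

Context (n : nat).
Local Notation E := 'rV[R]_n.

(* C_0^oo([0,T) x R^n).  The elements are given by an extension which is smooth
   on the whole of R x R^n (smoothness up to t = 0); only its values on
   [0,T) x R^n are constrained, and only those are used below. *)
Definition test_function (T : \bar R) (phi : R * E -> R) : Prop :=
  let slab := [set z : R * E | time_interval T z.1] in
  let supp := closure [set z | slab z /\ phi z != 0] in
  [/\ smooth phi, compact supp & supp `<=` slab].

Definition dt (phi : R * E -> R) : R * E -> R := 'D_(1, 0) phi.

Definition laplacian (phi : R * E -> R) : R * E -> R := fun z =>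
  \sum_(i < n)
    'D_(0, delta_mx ord0 i) ('D_(0, delta_mx ord0 i) phi) z.

End test_functions.

(* Throughout, msq stands for the mass parameter m^2 and Gam for Gamma. *)
Section cauchy_problem.
Context (R : realType) (n : nat).
Local Notation E := 'rV[R]_n.
Local Notation leb := (lebesgue_rV R n).
Local Notation lebT := (@lebesgue_measure R).

Definition Lp_mass (p : R) (u : E -> R) : \bar R :=
  (\int[leb]_y (`|u y| `^ p)%:E)%E.

(* f(t, v), with values in \bar R since the Lp_mass may be infinite for some t;
   the conventions are 0 * oo = 0, and r `^ 0 = 1 for every r. *)
Definition nonlinearity (Gam : R -> R) (beta p : R) (v : R -> E -> R)
    (z : R * E) : \bar R :=
  ((Gam z.1)%:E * (Lp_mass p (v z.1)) `^ beta * (`|v z.1 z.2| `^ p)%:E)%E.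

(* The two sides of the integral identity are compared in \bar R: the equality
   with a finite left-hand side forces the last integral to be finite. *)
Definition weak_identity (c H b msq beta p : R) (Gam : R -> R)
    (v0 v1 : E -> R) (eps : R) (v dv : R -> E -> R)
    (phi : R * E -> R) (t : R) : Prop :=
  (\int[leb]_x (dv t x * phi (t, x))
   - \int[leb]_x (v t x * dt phi (t, x))
   + b * \int[leb]_x (v t x * phi (t, x))
   + \int[lebT]_(s in `[0, t]) \int[leb]_x
       (v s x * (dt (dt phi) (s, x)
                 - c ^+ 2 * expR (2 * H * s) * laplacian phi (s, x)
                 - b * dt phi (s, x) + msq * phi (s, x))))%:E
  = ((eps * \int[leb]_x (v1 x * phi (0, x))
      + eps * \int[leb]_x (v0 x * (b * phi (0, x) - dt phi (0, x))))%:E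
     + \int[lebT]_(s in `[0%R, t])
         ((Gam s)%:E * (Lp_mass p (v s)) `^ beta *
          \int[leb]_x (`|v s x| `^ p * phi (s, x))%:E))%E.

(* The class of dv t is determined by v for every t in [0,T), so that the choice
   of dv is immaterial. *)
Definition weak_solution (c H b msq beta p : R) (Gam : R -> R)
    (rad : R) (v0 v1 : E -> R) (eps : R) (T : \bar R) (v : R -> E -> R) : Prop :=
  exists dv : R -> E -> R,
  [/\ C1_L1loc T v dv,
      L1loc_spacetime T (nonlinearity Gam beta p v),
      (forall t, 0 < t -> (t%:E < T)%E ->
         ess_supp (v t) `<=` eucl_ball (rad + c * H^-1 * (expR (H * t) - 1))) &
      forall phi, test_function T phi ->
        forall t, 0 < t -> (t%:E < T)%E ->
        weak_identity c H b msq beta p Gam v0 v1 eps v dv phi t].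

(* v is a weak solution on [0,T) which cannot be continued, as a weak solution,
   to a longer time interval. *)
Definition has_lifespan (c H b msq beta p : R) (Gam : R -> R)
    (rad : R) (v0 v1 : E -> R) (eps : R) (v : R -> E -> R) (T : \bar R) : Prop :=
  [/\ (0 < T)%E,
      weak_solution c H b msq beta p Gam rad v0 v1 eps T v &
      forall (T' : \bar R) (w : R -> E -> R), (T < T')%E ->
        weak_solution c H b msq beta p Gam rad v0 v1 eps T' w ->
        ~ (forall t, time_interval T t -> {ae leb, forall x, w t x = v t x})].

End cauchy_problem.

Section critical_exponents.
Context (R : realType).

Definition rho_crit (n : nat) (H b msq beta p : R) : R :=
  2^-1 * (b - Num.sqrt (b ^+ 2 - 4 * msq)) * ((beta + 1) * p - 1)
  + n%:R * H * (beta + 1) * (p - 1).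

Definition kappa_crit (b msq beta p : R) : R :=
  if 4 * msq < b ^+ 2 then -1 else -1 - (beta + 1) * p.

Definition lifespan_exponent (b msq beta p sigma : R) : R :=
  if 4 * msq < b ^+ 2 then - (((beta + 1) * p - 1) / (sigma + 1))
  else - ((sigma + 2) / ((beta + 1) * p - 1) + 1)^-1.

End critical_exponents.

(* Main.v *)
Require Import Defs.
From mathcomp Require Import finmap.
From mathcomp Require Import all_boot all_order all_algebra.
From mathcomp Require Import all_classical all_reals all_analysis.
From mathcomp Require Import measurable_realfun ring lra.

Set Implicit Arguments.
Unset Strict Implicit.
Unset Printing Implicit Defensive.
Import Order.TTheory GRing.Theory Num.Theory.
Import numFieldNormedType.Exports.

Local Open Scope classical_set_scope.
Local Open Scope ring_scope.

(** The growth rate of Gamma is critical because it is exactly the one for which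
    the spatial mean of the solution satisfies a superlinear integral inequality
    with a merely polynomial weight.  Put q = (beta + 1) p,
    delta = sqrt (b ^ 2 - 4 m ^ 2), al = (b - delta) / 2, and let U t be the
    integral of v t.

    Duhamel's formula.  Let K be the solution of K'' + b K' + m^2 K = 0 with
    K 0 = 0 and K' 0 = 1.  On the support of v the test function
    phi (s, x) = K (t - s) is annihilated by the adjoint operator, and K 0 = 0
    removes the time derivative of v at t from the boundary terms; the integral
    identity becomes (duhamel_ge)
      U t = eps (K t J1 + (b K t + K' t) J0)
            + int_0^t Gamma s M s ^ beta M s K (t - s) ds,
    where J0, J1 are the integrals of v0, v1 and M s is that of |v s| ^ p.
    The cutoffs that make phi a test function come from exp (- 1 / x).

    Lower bounds.  Hoelder's inequality on the light cone, whose radius is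
    O(exp (H s)), bounds M s below by U s ^ p exp (- n H (p - 1) s) up to a
    constant (Lp_mass_ge), while exp (al r) K r >= r / (1 + delta r)
    (damped_kernel).  All exponentials cancel for W t = exp (al t) U t, and
      W t >= c int (1 + s) ^ sigma W s ^ q (t - s) / (1 + delta (t - s)) ds
    over any subinterval of [0, t] on which W is positive (mean_step); moreover
    the data give W t >= eps (t / (1 + delta t) J1 + J0) (mean_hom_ge).

    Blow-up.  On [L, 2 L], starting from W >= A0, the inequality is iterated
    over the shrinking windows [2 L - L / 2 ^ j, 2 L]; the lower bounds grow
    geometrically, which is absurd at time 2 L, once
    L ^ (sigma + 2) A0 ^ (q - 1) / (1 + delta L) exceeds a constant
    (slicing_blowup).  For delta > 0 one takes A0 = eps J0, so the requirement is
    L ^ (sigma + 1) eps ^ (q - 1) >= const; for delta = 0 one takes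
    A0 = eps L J1, and it is L ^ (sigma + 1 + q) eps ^ (q - 1) >= const.  These
    are the two lifespan estimates. *)

(** * Functions of class C^k *)

Section Ck_closure.
Context (R : realType) (V : normedModType R).
Implicit Types (f g : V -> R) (k : nat).

Lemma Ck_continuous k f : Ck k f -> continuous f.
Proof. by case: k => [|k] []. Qed.

Lemma Ck_derivable k f : Ck k.+1 f -> forall v z, derivable f z v.
Proof. by move=> [_ df] v z; have [] := df v. Qed.

Lemma CkS k f : Ck k.+1 f -> Ck k f.
Proof.
elim: k f => [|k IH] f; first by move=> [].
by move=> [cf df]; split=> // v; have [dfv /IH] := df v.
Qed.

Lemma Ck_cst k (a : R) : Ck k (fun _ : V => a).
Proof.
elim: k a => [|k IH] a; split=> //; try by move=> x; exact: cvg_cst.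
move=> v; split=> [z|]; first exact: derivable_cst.
rewrite (_ : 'D_v _ = fun=> 0)//.
by apply/funext => z; exact: derive_cst.
Qed.

Lemma CkD k f g : Ck k f -> Ck k g -> Ck k (fun z => f z + g z).
Proof.
elim: k f g => [|k IH] f g [cf df] [cg dg].
  by split=> // x; apply: cvgD; [exact: cf|exact: cg].
split=> [x|v]; first by apply: cvgD; [exact: cf|exact: cg].
have [fv Cf] := df v; have [gv Cg] := dg v.
split=> [z|]; first by have := derivableD (fv z) (gv z).
rewrite (_ : 'D_v _ = fun z => 'D_v f z + 'D_v g z); first exact: IH.
by apply/funext => z; rewrite -deriveD.
Qed.

Lemma CkM k f g : Ck k f -> Ck k g -> Ck k (fun z => f z * g z).
Proof.
elim: k f g => [|k IH] f g Cf Cg.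
  split=> // x; apply: cvgM.
    exact: (Ck_continuous Cf).
  exact: (Ck_continuous Cg).
split=> [x|v].
  by apply: cvgM; [exact: (Ck_continuous Cf)|exact: (Ck_continuous Cg)].
have fv z : derivable f z v by exact: (Ck_derivable Cf).
have gv z : derivable g z v by exact: (Ck_derivable Cg).
split=> [z|]; first by have := derivableM (fv z) (gv z).
rewrite (_ : 'D_v _ = fun z => f z * 'D_v g z + g z * 'D_v f z).
  have [_ /(_ v)[_ Cdf]] := Cf; have [_ /(_ v)[_ Cdg]] := Cg.
  exact: CkD (IH _ _ (CkS Cf) Cdg) (IH _ _ (CkS Cg) Cdf).
by apply/funext => z; rewrite deriveM.
Qed.

Lemma CkV k f : (forall z, f z != 0) -> Ck k f -> Ck k (fun z => (f z)^-1).
Proof.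
move=> f0; elim: k => [|k IH] Cf.
  by split=> // x; apply: cvgV => //; exact: (Ck_continuous Cf).
split=> [x|v]; first by apply: cvgV => //; exact: (Ck_continuous Cf).
have fv z : derivable f z v by exact: (Ck_derivable Cf).
split=> [z|]; first by have := derivableV (f0 z) (fv z).
rewrite (_ : 'D_v _ = fun z => -1 * ((f z)^-1 * (f z)^-1 * 'D_v f z)).
  apply: CkM; first exact: Ck_cst.
  have Cf1 : Ck k (fun z => (f z)^-1) by apply: IH; exact: CkS.
  apply: CkM; first exact: CkM.
  by have [_ /(_ v)[]] := Cf.
by apply/funext => z; rewrite deriveV// mulN1r expr2 invfM scaleNr.
Qed.

Lemma Ck_prod k (I : finType) (F : I -> V -> R) :
  (forall i, Ck k (F i)) -> Ck k (fun z => \prod_i F i z).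
Proof.
move=> CF; elim: (index_enum I) => [|i s IH].
  rewrite (_ : (fun _ => _) = fun=> 1); first exact: Ck_cst.
  by apply/funext => z; rewrite big_nil.
rewrite (_ : (fun _ => _) = fun z => F i z * \prod_(j <- s) F j z).
  exact: CkM.
by apply/funext => z; rewrite big_cons.
Qed.

End Ck_closure.

Section Ck_affine.
Context (R : realType) (U V : normedModType R).

(** No chain rule is involved: the difference quotient of z |-> f (a + l z) in
    the direction v is that of f in the direction l v. *)
Lemma derive_comp_linear (l : U -> V) (a : V) (f : V -> R) (z v : U) : linear l ->
  'D_v (fun z => f (a + l z)) z = 'D_(l v) f (a + l z) /\
  (derivable f (a + l z) (l v) -> derivable (fun z => f (a + l z)) z v).
Proof.
move=> linl; rewrite /derive /derivable.
rewrite (_ : (fun h : R => h^-1 *: ((f (a + l (h *: v + z))) - f (a + l z))) =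
   (fun h : R => h^-1 *: (f (h *: l v + (a + l z)) - f (a + l z)))) //.
by apply/funext => h; rewrite linl addrCA.
Qed.

Lemma Ck_comp_affine (l : U -> V) (a : V) k (f : V -> R) :
  linear l -> continuous l -> Ck k f -> Ck k (fun z => f (a + l z)).
Proof.
move=> linl cl; elim: k f => [|k IH] f Cf.
  split=> // z; apply: (@continuous_comp _ _ _ (fun z => a + l z) f).
    by apply: cvgD; [exact: cvg_cst|exact: cl].
  exact: (Ck_continuous Cf).
split=> [z|v].
  apply: (@continuous_comp _ _ _ (fun z => a + l z) f).
    by apply: cvgD; [exact: cvg_cst|exact: cl].
  exact: (Ck_continuous Cf).
split=> [z|].
  have fd : derivable f (a + l z) (l v) by exact: (Ck_derivable Cf).
  by have := (derive_comp_linear a f z v linl).2 fd.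
rewrite (_ : 'D_v _ = fun z => 'D_(l v) f (a + l z)).
  by have [_ /(_ (l v))[_ /IH]] := Cf.
by apply/funext => z; exact: (derive_comp_linear a f z v linl).1.
Qed.

End Ck_affine.

Section Ck_real.
Context (R : realType).
Implicit Types (f : R -> R).

Lemma derive_scale f (x v d : R) : is_derive x 1 f d ->
  derivable f x v /\ 'D_v f x = v * d.
Proof.
move=> [fx fd].
have df : differentiable f x by apply/derivable1_diffP.
split; first exact: diff_derivable.
by rewrite deriveE// deriv1E// derive1E fd.
Qed.

Lemma Ck_primitive k f (f' : R -> R) :
  (forall x : R, is_derive x (1 : R) f (f' x)) -> Ck k (f' : R -> R) -> Ck k.+1 f.
Proof.
move=> ff' Cf'; split=> [x|v].
  apply: differentiable_continuous; apply/derivable1_diffP.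
  by have [] := ff' x.
split=> [z|]; first exact: (derive_scale v (ff' z)).1.
rewrite (_ : 'D_v f = fun x => v * f' x); first by apply: CkM => //; exact: Ck_cst.
by apply/funext => z; exact: (derive_scale v (ff' z)).2.
Qed.

End Ck_real.

(** * Smooth cutoffs *)

Section flat.
Context (R : realType).

(** The negative powers of x make the family stable under differentiation (see
    is_derive_flat), so that all its members are shown smooth simultaneously. *)
Definition flat k (x : R) : R := if 0 < x then x^-1 ^+ k * expR (- x^-1) else 0.

Lemma flat_le0 k x : x <= 0 -> flat k x = 0.
Proof. by rewrite /flat leNgt => /negbTE ->. Qed.

Lemma flat_ge0 k x : 0 <= flat k x.
Proof.
rewrite /flat; case: ifPn => // x0.
by rewrite mulr_ge0 ?expR_ge0// exprn_ge0// invr_ge0 ltW.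
Qed.

Lemma flat_gt0 x : 0 < x -> 0 < flat 0 x.
Proof. by move=> x0; rewrite /flat x0 expr0 mul1r expR_gt0. Qed.

(** Quadratic flatness at 0 suffices for differentiability there; it follows from
    y ^ (k + 2) / (k + 2)! <= exp y at y = 1 / x. *)
Lemma flat_le_sqr k x : flat k x <= (k.+2)`!%:R * x ^+ 2.
Proof.
rewrite /flat; case: ifPn => [x0|_]; last by rewrite mulr_ge0// sqr_ge0.
have y0 : 0 < x^-1 by rewrite invr_gt0.
rewrite expRN ler_pdivrMr ?expR_gt0//.
have := @expR_ge1Dxn R x^-1 k.+1 (ltW y0).
rewrite addrC -lerBrDr => h.
have {h} : x^-1 ^+ k.+2 / k.+2`!%:R <= expR x^-1.
  by apply: (le_trans h); rewrite gerBl.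
rewrite ler_pdivrMr ?ltr0n ?fact_gt0// => h.
have -> : x^-1 ^+ k = x ^+ 2 * x^-1 ^+ k.+2.
  transitivity ((x * x^-1) ^+ 2 * x^-1 ^+ k).
    by rewrite divff ?gt_eqF// expr1n mul1r.
  by move: x^-1 => y; rewrite !exprS; ring.
rewrite [leRHS](_ : _ = x ^+ 2 * (expR x^-1 * k.+2`!%:R)); last by ring.
by rewrite ler_pM2l ?exprn_gt0.
Qed.

Lemma is_derive_flat k (x : R) :
  is_derive x 1 (flat k) (flat k.+2 x - k%:R * flat k.+1 x).
Proof.
have [x0|x0|->] := ltgtP x 0.
- rewrite !flat_le0 ?(ltW x0)// mulr0 subr0.
  apply: (@near_eq_is_derive _ _ _ (cst 0)).
  near=> y; rewrite flat_le0//; apply/ltW; near: y; exact: lt_nbhsl.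
- rewrite [flat k.+2 x]/flat [flat k.+1 x]/flat x0.
  have xn0 : x != 0 by rewrite gt_eqF.
  have dV : is_derive x 1 (fun y : R => y^-1) (- x ^- 2).
    apply: is_derive_eq; first exact: (@is_deriveV _ id).
    by rewrite /GRing.scale/= mulr1.
  have dE : is_derive x 1 (fun y : R => expR (- y^-1)) (expR (- x^-1) * x ^- 2).
    apply: (@is_derive1_comp _ expR (fun y => - y^-1)).
    by apply: is_derive_eq; rewrite opprK.
  have dF : is_derive x 1 (fun y : R => y^-1 ^+ k * expR (- y^-1))
      (x^-1 ^+ k.+2 * expR (- x^-1) - k%:R * (x^-1 ^+ k.+1 * expR (- x^-1))).
    rewrite (_ : (fun y => _) =
      ((fun y => y^-1) ^+ k : R -> R) * (fun y => expR (- y^-1)) :> (R -> R));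
      last by apply/funext => y; rewrite /= exprfctE.
    apply: is_derive_eq.
    rewrite /GRing.scale/= !exprfctE -!exprVn.
    move: x^-1 (expR _) => y e.
    case: k => [|k]; first by rewrite /= !exprS; ring.
    by rewrite /= !exprS; ring.
  apply: near_eq_is_derive dF.
  by near=> y; rewrite /flat ifT//; near: y; exact: lt_nbhsr.
- (* at 0 the difference quotient is O(h), by flat_le_sqr *)
  rewrite !flat_le0// mulr0 subr0.
  have lim0 : (fun h : R => h^-1 *: ((flat k \o shift 0) (h *: 1) - flat k 0))
      @ 0^' --> (0 : R).
    apply: norm_cvg0.
    apply: (@squeeze_cvgr _ _ _ _ (cst 0) (fun h => k.+2`!%:R * `|h|)).
    - near=> h; rewrite normr_ge0/= addr0 [h *: 1]mulr1 (flat_le0 _ (lexx 0)).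
      rewrite subr0 normrM normfV (ger0_norm (flat_ge0 _ _)).
      have hn0 : h != 0 by near: h; exact: nbhs_dnbhs_neq.
      rewrite ler_pdivrMl ?normr_gt0// (le_trans (flat_le_sqr _ _))//.
      by rewrite [leRHS]mulrCA -(real_normK (num_real h)) expr2.
    - exact: cvg_cst.
    - have /(cvgMl_tmp (a := (k.+2`!%:R : R))) : (fun h : R => `|h|) @ 0^' --> (0 : R).
        by apply/norm_cvg0P; exact: nbhs_dnbhs.
      by rewrite mulr0.
  split; first by apply/cvg_ex; exists 0.
  exact/cvg_lim.
Unshelve. all: by end_near. Qed.

Lemma Ck_flat j k : Ck j (flat k).
Proof.
elim: j k => [|j IH] k.
  split=> // x; apply: differentiable_continuous; apply/derivable1_diffP.
  by have [] := is_derive_flat k x.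
apply: Ck_primitive (is_derive_flat k) _.
apply: (@CkD _ _ _ (flat k.+2) (fun x => - (k%:R * flat k.+1 x))); first exact: IH.
rewrite (_ : (fun _ => _) = fun x => - k%:R * flat k.+1 x).
  by apply: CkM; [exact: Ck_cst|exact: IH].
by apply/funext => x; rewrite mulNr.
Qed.

End flat.

Section cutoff.
Context (R : realType).
Implicit Types (a x : R).

Definition cutoff a x : R :=
  flat 0 (a + 1 - x) / (flat 0 (a + 1 - x) + flat 0 (x - a)).

(** The two flat functions vanish on half-lines that do not meet. *)
Lemma cutoff_den a x : 0 < flat 0 (a + 1 - x) + flat 0 (x - a).
Proof.
have [xa|xa] := ltP x (a + 1).
  by rewrite ltr_pwDl ?flat_ge0// flat_gt0// subr_gt0.
by rewrite ltr_wpDl ?flat_ge0// flat_gt0//; lra.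
Qed.

Lemma cutoff1 a x : x <= a -> cutoff a x = 1.
Proof.
move=> xa; rewrite /cutoff (@flat_le0 _ 0 (x - a)) ?subr_le0// addr0 divff//.
by rewrite gt_eqF// flat_gt0//; lra.
Qed.

Lemma cutoff0 a x : a + 1 <= x -> cutoff a x = 0.
Proof. by move=> ax; rewrite /cutoff flat_le0 ?subr_le0// mul0r. Qed.

Lemma cutoff_ge0 a x : 0 <= cutoff a x.
Proof. by rewrite divr_ge0 ?flat_ge0// ltW// cutoff_den. Qed.

Lemma Ck_cutoff k a : Ck k (cutoff a).
Proof.
have C1 : Ck k (fun x => flat 0 (a + 1 - x)).
  apply: (@Ck_comp_affine R R R -%R (a + 1) k (flat 0)); last exact: Ck_flat.
    exact: linearP.
  exact: opp_continuous.
have C2 : Ck k (fun x => flat 0 (x - a)).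
  rewrite (_ : (fun _ => _) = fun x => flat 0 (- a + idfun x)).
    apply: (@Ck_comp_affine R R R idfun (- a) k (flat 0)) => //.
      by move=> ?; exact: cvg_id.
    exact: Ck_flat.
  by apply/funext => x; rewrite addrC.
apply: CkM => //; apply: CkV; last exact: CkD.
by move=> z; rewrite gt_eqF// cutoff_den.
Qed.

End cutoff.

(** * Boxes for the sup norm *)

Section sup_norm.
Context (R : realType) (n : nat).
Implicit Types (x : 'rV[R]_n) (A : R).

Lemma rV_norm_leP x A : 0 <= A ->
  reflect (forall i, `|x ord0 i| <= A) (`|x| <= A).
Proof.
move=> A0; have -> : `|x| = \big[Num.max/0]_ij `|x ij.1 ij.2| by exact: mx_normrE.
apply: (iffP idP) => [/bigmax_leP[_ h] i|h]; first exact: (h (ord0, i)).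
by apply/bigmax_leP; split=> // -[i j] _ /=; rewrite (ord1 i).
Qed.

Lemma compact_rV_le A : compact [set x : 'rV[R]_n | `|x| <= A].
Proof.
apply: bounded_closed_compact.
  exists A; split=> [|M AM x /= xA]; first exact: num_real.
  by rewrite (le_trans xA)// ltW.
apply: (@closed_comp _ _ _ [set a : R | a <= A]) => //.
  by move=> x _; exact: norm_continuous.
Qed.

Lemma compact_rV_annulus A B : compact [set x : 'rV[R]_n | A <= `|x| <= B].
Proof.
rewrite (_ : [set _ | _] = [set x : 'rV[R]_n | `|x| <= B] `&` [set x : 'rV[R]_n | A <= `|x|]).
  apply: compact_closedI; first exact: compact_rV_le.
  apply: (@closed_comp _ _ _ [set a : R | A <= a]) => //.
    by move=> x _; exact: norm_continuous.
by apply/seteqP; split=> x /=; [move=> /andP[]|move=> [-> ->]].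
Qed.

Lemma measurable_rV_le A : 0 <= A -> measurable [set x : 'rV[R]_n | `|x| <= A].
Proof.
move=> A0.
rewrite (_ : [set x | _] = \bigcap_(i in setT) (@rV_coord R n i @^-1` `[- A, A])).
  apply: fin_bigcap_measurable => [|i _]; first exact: finite_finset.
  by rewrite -[X in measurable X]setTI; exact: measurable_rV_coord.
apply/seteqP; split=> x /=.
  by move=> /(rV_norm_leP _ A0) h i _ /=; rewrite in_itv/= -ler_norml; exact: h.
move=> h; apply/(rV_norm_leP _ A0) => i.
by have := h i I; rewrite /= in_itv/= -ler_norml.
Qed.

Lemma lebesgue_rV_le A : 0 <= A ->
  lebesgue_rV R n [set x : 'rV[R]_n | `|x| <= A] = ((2 * A) ^+ n)%:E.
Proof.
move=> A0.
rewrite (_ : [set x | _] = [set x : 'rV[R]_n | forall i, `[- A, A]%classic (x ord0 i)]).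
  rewrite (lebesgue_rV_box (A := fun=> `[- A, A]%classic))//.
  rewrite (eq_bigr (fun=> (2 * A)%:E)); last first.
    move=> i _; rewrite lebesgue_measure_itv/= lte_fin.
    case: ltP => h; first by rewrite -EFinB opprK mulr2n mulrDl mul1r.
    have -> : A = 0 by apply/eqP; rewrite eq_le A0 andbT; lra.
    by rewrite mulr0.
  by rewrite prodEFin prodr_const card_ord.
apply/seteqP; split=> x /=.
  by move=> /(rV_norm_leP _ A0) h i; rewrite in_itv/= -ler_norml; exact: h.
move=> h; apply/(rV_norm_leP _ A0) => i.
by have := h i; rewrite in_itv/= -ler_norml.
Qed.

Lemma eucl_ball_sub A : 0 <= A -> eucl_ball A `<=` [set x : 'rV[R]_n | `|x| <= A].
Proof.
move=> A0 x /= xA; apply/(rV_norm_leP _ A0) => i.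
apply: (le_trans _ xA); rewrite -sqrtr_sqr ler_wsqrtr//.
rewrite (bigD1 i)//= lerDl; apply: sumr_ge0 => j _; exact: sqr_ge0.
Qed.

End sup_norm.

Section box_cutoff.
Context (R : realType) (n : nat).
Implicit Types (x : 'rV[R]_n) (A : R).

Definition box_cutoff A x : R :=
  \prod_(i < n) (cutoff A (x ord0 i) * cutoff A (- x ord0 i)).

Lemma box_cutoff1 A x : `|x| <= A -> box_cutoff A x = 1.
Proof.
move=> xA; have A0 : 0 <= A := le_trans (normr_ge0 _) xA.
apply: big1 => i _; have := (rV_norm_leP _ A0 xA) i.
by rewrite ler_norml => /andP[h1 h2]; rewrite !cutoff1 ?mulr1//; lra.
Qed.

Lemma box_cutoff_supp A x : 0 <= A -> box_cutoff A x != 0 -> `|x| <= A + 1.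
Proof.
move=> A0 /prodf_neq0 h; apply/rV_norm_leP; first by lra.
move=> i; have {h} := h i isT; rewrite mulf_eq0 negb_or => /andP[h1 h2].
rewrite ler_norml; apply/andP; split; rewrite leNgt; apply/negP => h.
  by move/negP: h2; apply; apply/eqP/cutoff0; lra.
by move/negP: h1; apply; apply/eqP/cutoff0; lra.
Qed.

Lemma box_cutoff_ge0 A x : 0 <= box_cutoff A x.
Proof. by apply: prodr_ge0 => i _; rewrite mulr_ge0 ?cutoff_ge0. Qed.

Lemma Ck_box_cutoff k A : Ck k (box_cutoff A).
Proof.
apply: Ck_prod => i; apply: CkM.
  rewrite (_ : (fun _ => _) = fun x : 'rV[R]_n => cutoff A (0 + x ord0 i)).
    apply: (@Ck_comp_affine R 'rV[R]_n R (fun x => x ord0 i)); last exact: Ck_cutoff.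
      by move=> a x y; rewrite !mxE.
    exact: (@coord_continuous R 1 n ord0 i).
  by apply/funext => x; rewrite add0r.
rewrite (_ : (fun _ => _) = fun x : 'rV[R]_n => cutoff A (0 + - x ord0 i)).
  apply: (@Ck_comp_affine R 'rV[R]_n R (fun x => - x ord0 i)); last exact: Ck_cutoff.
    by move=> a x y; rewrite !mxE opprD scalerN.
  move=> x; apply: (@continuous_comp _ _ _ (fun x : 'rV[R]_n => x ord0 i) -%R).
    exact: (@coord_continuous R 1 n ord0 i).
  exact: opp_continuous.
by apply/funext => x; rewrite add0r.
Qed.

Lemma measurable_box_cutoff A : measurable_fun setT (box_cutoff A).
Proof.
have mc : measurable_fun setT (cutoff A : R -> R).
  apply: continuous_measurable_fun; exact: (Ck_continuous (Ck_cutoff 0 A)).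
apply: measurable_prod => i _; apply: measurable_funM.
  exact: (measurableT_comp mc (measurable_rV_coord i)).
apply: (measurableT_comp mc); apply: measurable_funN; exact: measurable_rV_coord.
Qed.

End box_cutoff.

(** * Test functions and the fundamental solution of the damped oscillator *)

Section product_function.
Context (R : realType) (n : nat).
Local Notation E := 'rV[R]_n.
Implicit Types (G : R -> R) (P : E -> R).

Lemma smooth_product G P : smooth G -> smooth P ->
  smooth (fun z : R * E => G z.1 * P z.2).
Proof.
move=> CG CP k; apply: CkM.
  rewrite (_ : (fun _ => _) = fun z : R * E => G (0 + z.1)).
    apply: (@Ck_comp_affine R (R * E)%type R fst); last exact: CG.
      by [].
    by move=> z; exact: cvg_fst.
  by apply/funext => z; rewrite add0r.
rewrite (_ : (fun _ => _) = fun z : R * E => P (0 + z.2)).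
  apply: (@Ck_comp_affine R (R * E)%type E snd); last exact: CP.
    by [].
  by move=> z; exact: cvg_snd.
by apply/funext => z; rewrite add0r.
Qed.

Lemma derive_product G P (a : R) (e : E) : smooth G -> smooth P ->
  'D_(a, e) (fun z : R * E => G z.1 * P z.2)
  = fun z => G z.1 * 'D_e P z.2 + P z.2 * 'D_a G z.1.
Proof.
move=> CG CP; apply/funext => z.
have [] := @derive_comp_linear R (R * E)%type R fst 0 G z (a, e) _; first by [].
rewrite (_ : (fun z : R * E => G (0 + z.1)) = (fun z => G z.1)); last first.
  by apply/funext => y; rewrite add0r.
rewrite add0r /= => DG dG.
have {}dG : derivable (fun z : R * E => G z.1) z (a, e).
  by apply: dG; exact: (Ck_derivable (CG 1)).
have [] := @derive_comp_linear R (R * E)%type E snd 0 P z (a, e) _; first by [].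
rewrite (_ : (fun z : R * E => P (0 + z.2)) = (fun z => P z.2)); last first.
  by apply/funext => y; rewrite add0r.
rewrite add0r /= => DP dP.
have {}dP : derivable (fun z : R * E => P z.2) z (a, e).
  by apply: dP; exact: (Ck_derivable (CP 1)).
have := deriveM dG dP; rewrite DP DG; exact.
Qed.

Lemma dt_product G P : smooth G -> smooth P ->
  dt (fun z : R * E => G z.1 * P z.2) = fun z => 'D_1 G z.1 * P z.2.
Proof.
move=> CG CP; rewrite /dt derive_product//; apply/funext => z.
by rewrite derive0 mulr0 add0r mulrC.
Qed.

Lemma dx_product G P (e : E) : smooth G -> smooth P ->
  'D_(0, e) (fun z : R * E => G z.1 * P z.2) = fun z => G z.1 * 'D_e P z.2.
Proof.
move=> CG CP; rewrite derive_product//; apply/funext => z.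
by rewrite derive0 mulr0 addr0.
Qed.

Lemma smooth_derive (V : normedModType R) (f : V -> R) (v : V) :
  smooth f -> smooth ('D_v f).
Proof. by move=> Cf k; have [_ /(_ v)[]] := Cf k.+1. Qed.

End product_function.

Section test_function_existence.
Context (R : realType) (n : nat).
Local Notation E := 'rV[R]_n.
Implicit Types (g : R -> R) (A s : R).

Lemma between_time (t : R) (T : \bar R) : (t%:E < T)%E ->
  exists t1 t2 : R, [/\ t < t1, t1 < t2 & (t2%:E < T)%E].
Proof.
case: T => [r| |]//; last by move=> _; exists (t + 1), (t + 2); rewrite ltry; split=> //; lra.
by rewrite lte_fin => tr; exists ((3 * t + r) / 4), ((t + r) / 2); rewrite lte_fin; split; lra.
Qed.

(** The transition in time takes place strictly between t and T, and the one in
    space outside the box of size A; hence at the times s <= t the derivatives of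
    phi are those of the factor g, and the Laplacian vanishes on the box. *)
Lemma exists_test_function (T : \bar R) (t A : R) (g g1 g2 : R -> R) :
  (t%:E < T)%E -> 0 < A -> smooth g ->
  (forall s : R, is_derive s 1 g (g1 s)) -> (forall s : R, is_derive s 1 g1 (g2 s)) ->
  exists2 phi : R * E -> R, test_function T phi &
    exists psi : E -> R,
    [/\ (forall x, `|x| <= A -> psi x = 1), (forall x, 0 <= psi x),
        measurable_fun setT psi &
     [/\ (forall s x, s <= t -> phi (s, x) = g s * psi x),
        (forall s x, s <= t -> dt phi (s, x) = g1 s * psi x),
        (forall s x, s <= t -> dt (dt phi) (s, x) = g2 s * psi x) &
        (forall s x, s <= t -> `|x| < A -> laplacian phi (s, x) = 0)]].
Proof.
move=> tT A0 Cg Dg Dg1.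
have [t1 [t2 [tt1 t12 t2T]]] := between_time tT.
pose theta s := cutoff 0 (- (t1 / (t2 - t1)) + s / (t2 - t1)).
have d0 : 0 < t2 - t1 by lra.
have thE s : - (t1 / (t2 - t1)) + s / (t2 - t1) = (s - t1) / (t2 - t1).
  by rewrite mulrBl addrC.
have theta1 s : s <= t1 -> theta s = 1.
  by move=> st; apply: cutoff1; rewrite thE pmulr_lle0 ?invr_gt0//; lra.
have theta0 s : t2 <= s -> theta s = 0.
  move=> st; apply: cutoff0; rewrite thE add0r ler_pdivlMr//; lra.
have Ct : smooth theta.
  move=> k; apply: (@Ck_comp_affine R R R (fun s => s / (t2 - t1))); last exact: Ck_cutoff.
    by move=> a x y; rewrite mulrDl -mulrA.
  by move=> x; apply: cvgMr_tmp; exact: cvg_id.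
pose G s := g s * theta s.
have CG : smooth G by move=> k; exact: CkM.
have Gg s : s < t1 -> \forall y \near s, g y = G y.
  move=> st; near=> y; rewrite /G theta1 ?mulr1//.
  by apply/ltW; near: y; exact: lt_nbhsl.
have G1 s : s < t1 -> 'D_1 G s = g1 s.
  by move=> st; rewrite -(@near_eq_derive R R R g G s 1 (Gg s st)); have [] := Dg s.
have G2 s : s < t1 -> 'D_1 ('D_1 G) s = g2 s.
  move=> st; rewrite -(_ : 'D_1 g1 s = g2 s); last by have [] := Dg1 s.
  by apply: (@near_eq_derive R R R); near=> y; rewrite G1//; near: y; exact: lt_nbhsl.
have CP : smooth (box_cutoff A : E -> R) by move=> k; exact: Ck_box_cutoff.
have dtE := dt_product CG CP.
have dttE := dt_product (@smooth_derive R R G 1 CG) CP.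
have dxE e := dx_product e CG CP.
have dxxE e := dx_product e CG (smooth_derive e CP).
exists (fun z => G z.1 * box_cutoff A z.2); last first.
  exists (box_cutoff A); split.
  - by move=> x; exact: box_cutoff1.
  - by move=> x; exact: box_cutoff_ge0.
  - exact: measurable_box_cutoff.
  split.
  - by move=> s x st; rewrite /= /G theta1 ?mulr1//; lra.
  - by move=> s x st; rewrite dtE/= G1//; lra.
  - by move=> s x st; rewrite dtE dttE/= G2//; lra.
  - move=> s x st xA; rewrite /laplacian big1// => i _.
    rewrite dxE; set e := delta_mx _ _.
    apply: (etrans (congr1 (fun f => f (s, x)) (dxxE e))) => /=.
    have nearA (y : E) : `|y| < A -> \forall z \near y, `|z| < A.
      by move=> yA; apply: (@cvgr_norm_lt _ _ _ (nbhs y) _ id y) => //; exact: cvg_id.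
    have D1 (y : E) : `|y| < A -> 'D_e (box_cutoff A) y = 0.
      move=> yA; rewrite -[RHS](@derive_cst _ _ _ (1 : R) y e).
      apply: near_eq_derive; near=> z; apply: box_cutoff1; apply/ltW.
      by near: z; exact: nearA.
    suff -> : 'D_e ('D_e (box_cutoff A)) x = 0 by rewrite mulr0.
    rewrite -[RHS](@derive_cst _ _ _ (0 : R) x e).
    by apply: near_eq_derive; near=> z; apply: D1; near: z; exact: nearA.
have suppK : closure [set z : R * E | time_interval T z.1 /\ G z.1 * box_cutoff A z.2 != 0]
    `<=` `[0, t2]%classic `*` [set x | `|x| <= A + 1].
  have cK : compact (`[0, t2]%classic `*` [set x : E | `|x| <= A + 1]).
    by apply: compact_setX; [exact: segment_compact|exact: compact_rV_le].
  rewrite [X in _ `<=` X](closure_id _).1; last first.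
    by apply: compact_closed => //; exact: norm_hausdorff.
  apply: closure_subset => -[s x] /= [[s0 _]].
  rewrite mulf_eq0 negb_or => /andP[Gs Px]; split.
    rewrite in_itv/= s0/= leNgt; apply/negP => t2s; move: Gs.
    by rewrite /G theta0 ?mulr0 ?eqxx// ltW.
  exact: box_cutoff_supp (ltW A0) Px.
split.
- exact: smooth_product.
- apply: (subclosed_compact _ _ suppK); first exact: closed_closure.
  by apply: compact_setX; [exact: segment_compact|exact: compact_rV_le].
- move=> z /suppK[/=]; rewrite in_itv/= => /andP[z0 zt2] _; split => //.
  by apply: le_lt_trans t2T; rewrite lee_fin.
Unshelve. all: by end_near. Qed.

End test_function_existence.

Section damped_kernel.
Context (R : realType).

(** The solution is explicit: exp (al r) K r is (1 - exp (- delta r)) / delta, or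
    r if delta = 0.  The common lower bound r / (1 + delta r) covers both cases by
    exp (- x) <= 1 / (1 + x), and lets them be treated together later on. *)
Lemma damped_kernel (b msq : R) (delta := Num.sqrt (b ^+ 2 - 4 * msq))
    (al := 2^-1 * (b - delta)) : 0 <= b -> 0 <= msq -> 4 * msq <= b ^+ 2 ->
  exists K K1 : R -> R,
  [/\ (forall r : R, is_derive r 1 K (K1 r)),
      (forall r : R, is_derive r 1 K1 (- b * K1 r - msq * K r)),
      K 0 = 0 /\ K1 0 = 1,
      (forall r, 0 <= r -> r / (1 + delta * r) <= expR (al * r) * K r) &
      (forall r, 0 <= r -> 1 <= expR (al * r) * (b * K r + K1 r))].
Proof.
move=> b0 m0 bm.
have d0 : 0 <= delta := sqrtr_ge0 _.
have d2 : delta ^+ 2 = b ^+ 2 - 4 * msq by rewrite sqr_sqrtr// subr_ge0.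
have al0 : 0 <= al.
  have : delta <= b by rewrite -[leRHS](ger0_norm b0) -sqrtr_sqr ler_wsqrtr//; lra.
  by rewrite /al; lra.
have De (c : R) (r : R) : is_derive r 1 (fun r => expR (- c * r)) (- c * expR (- c * r)).
  have Dc : is_derive r 1 (fun r => - c * r) (- c).
    apply: is_derive_eq; rewrite /GRing.scale/=; ring.
  by rewrite mulrC; apply: (@is_derive1_comp _ expR (fun r => - c * r)).
(* a double root al = b / 2 of the characteristic polynomial *)
have [dz|dn] := eqVneq delta 0.
  have alb : al = b / 2 by rewrite /al dz; lra.
  have mal : msq = al ^+ 2 by move: d2; rewrite dz alb; nra.
  exists (fun r => r * expR (- al * r)), (fun r => (1 - al * r) * expR (- al * r)).
  have ee r : expR (al * r) * expR (- al * r) = 1 by rewrite -expRD mulNr subrr expR0.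
  split.
  - move=> r; apply: is_derive_eq; rewrite /GRing.scale/=; ring.
  - move=> r; apply: is_derive_eq; rewrite /GRing.scale/= mal.
    have -> : b = 2 * al by rewrite alb; lra.
    by ring.
  - by rewrite mul0r mulr0 subr0 mul1r mulr0 expR0.
  - by move=> r r0; rewrite dz mul0r addr0 divr1 mulrCA ee mulr1.
  - move=> r r0.
    rewrite (_ : _ * _ = (1 + (b - al) * r) * (expR (al * r) * expR (- al * r)));
      last by ring.
    by rewrite ee mulr1 lerDl mulr_ge0//; lra.
have dp : 0 < delta by rewrite lt_neqAle eq_sym dn.
(* two roots - al and - la *)
pose la := al + delta.
have bE : b = al + la by rewrite /la /al; lra.
have mE : msq = al * la.
  by move: d2; rewrite /la; have -> : delta = b - 2 * al by [rewrite /al; lra]; nra.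
exists (fun r => delta^-1 * (expR (- al * r) - expR (- la * r))),
  (fun r => delta^-1 * (la * expR (- la * r) - al * expR (- al * r))).
have ee r : expR (al * r) * expR (- al * r) = 1 by rewrite -expRD mulNr subrr expR0.
have el r : expR (al * r) * expR (- la * r) = expR (- (delta * r)).
  by rewrite -expRD /la; congr expR; ring.
split.
- move=> r; have Da := De al r; have Dl := De la r.
  by apply: is_derive_eq; rewrite /GRing.scale/=; ring.
- move=> r; have Da := De al r; have Dl := De la r.
  by apply: is_derive_eq; rewrite /GRing.scale/= mE bE; ring.
- rewrite !mulr0 !expR0 subrr mulr0; split=> //.
  by rewrite !mulr1 /la addrAC subrr add0r mulVf.
- move=> r r0; rewrite mulrCA mulrBr ee el.
  have dr0 : 0 <= delta * r by rewrite mulr_ge0.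
  have : expR (- (delta * r)) <= (1 + delta * r)^-1.
    by rewrite expRN lef_pV2 ?posrE ?expR_gt0 ?expR_ge1Dx//; lra.
  move=> h; have -> : r / (1 + delta * r) = delta^-1 * (1 - (1 + delta * r)^-1).
    by field; rewrite dn/= gt_eqF//; lra.
  by rewrite ler_pM2l ?invr_gt0// lerD2l lerN2.
- move=> r r0.
  apply: (@le_trans _ _ (delta^-1 * (la * (expR (al * r) * expR (- al * r))
      - al * (expR (al * r) * expR (- la * r))))); last first.
    by rewrite le_eqVlt; apply/orP; left; apply/eqP; rewrite [in RHS]bE; ring.
  rewrite ee el mulr1 ler_pdivlMl// mulr1.
  have : expR (- (delta * r)) <= 1 by rewrite expR_le1 oppr_le0 mulr_ge0.
  by rewrite /la; nra.
Qed.

End damped_kernel.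

(** * Integrals without measurability, and supports *)

Section integral_nonmeasurable.
Local Open Scope ereal_scope.
Context d (T : measurableType d) (R : realType) (mu : {measure set T -> \bar R}).
Implicit Types (D : set T) (f g : T -> \bar R).

(** The integral of a nonnegative function is a supremum over the simple
    functions below it, hence monotone even without measurability. *)
Lemma ge0_le_integral_nomeas D f g :
  (forall x, D x -> 0 <= f x) -> (forall x, D x -> f x <= g x) ->
  \int[mu]_(x in D) f x <= \int[mu]_(x in D) g x.
Proof.
move=> f0 fg; rewrite !ge0_integralE//; last first.
  by move=> x Dx; rewrite (le_trans (f0 _ Dx))// fg.
apply: le_ereal_sup => _ [h /= hf <-]; exists h => // x /=.
apply: (le_trans (hf x)); rewrite !patchE; case: ifPn => // xD.
by apply: fg; rewrite inE in xD.
Qed.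

(** The positive and negative parts lie below +oo times the indicator of a
    measurable null set, whose integral is 0. *)
Lemma ae0_integral_nomeas D f :
  {ae mu, forall x, D x -> f x = 0} -> \int[mu]_(x in D) f x = 0.
Proof.
move=> [N [mN muN fN]].
have ge0_case g : (forall x, D x -> 0 <= g x) -> (forall x, D x -> f x = 0 -> g x = 0) ->
    \int[mu]_(x in D) g x = 0.
  move=> g0 gf; apply/eqP; rewrite eq_le; apply/andP; split; last first.
    by rewrite integral_mkcond; apply: integral_ge0 => x _; apply: erestrict_ge0.
  apply: (@le_trans _ _ (\int[mu]_(x in N) cst +oo x)).
    rewrite integral_mkcond [leRHS]integral_mkcond; apply: ge0_le_integral_nomeas => x _.
      by apply: erestrict_ge0.
    rewrite !patchE; case: ifPn => xD; last by case: ifPn => // _; exact: leey.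
    case: ifPn => xN; first by rewrite leey.
    rewrite gf//; first by rewrite inE in xD.
    apply: contrapT => fx; move/negP: xN; apply; rewrite inE; apply: fN => /=.
    by move=> /(_ (set_mem xD)).
  by rewrite integral_cst// muN mule0.
rewrite integralE !ge0_case ?sube0//.
  by move=> x Dx fx; rewrite funenegE fx oppe0 maxxx.
by move=> x Dx fx; rewrite funeposE fx maxxx.
Qed.

Lemma ae0_Rintegral_nomeas D (f : T -> R) :
  {ae mu, forall x, D x -> f x = 0%R} -> (\int[mu]_(x in D) f x = 0)%R.
Proof.
move=> f0; rewrite /Rintegral ae0_integral_nomeas//.
by apply: filterS f0 => x h Dx; rewrite h.
Qed.

End integral_nonmeasurable.

Section support.
Context (R : realType) (n : nat).
Local Notation E := 'rV[R]_n.
Local Notation leb := (lebesgue_rV R n).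
Implicit Types (u : E -> R) (rho A : R).

(** The annuli rho + 1/k <= |x| <= k are compact, so each is covered by finitely
    many open sets on which u is negligible. *)
Lemma ess_supp_ae0 u rho : 0 <= rho -> ess_supp u `<=` eucl_ball rho ->
  {ae leb, forall x, rho < `|x| -> u x = 0}.
Proof.
move=> rho0 su.
pose K (k : nat) := [set x : E | rho + k.+1%:R^-1 <= `|x| <= k%:R].
have Kae k : {ae leb, forall x, K k x -> u x = 0}.
  have : compact (K k) by exact: compact_rV_annulus.
  rewrite compact_cover => /(_ (set E) [set U : set E |
    open U /\ {ae leb, forall x, U x -> u x = 0}] id).
  case=> [U []//|x Kx|F FU KF].
    apply: contrapT => nx; have /su/(eucl_ball_sub rho0)/= : ess_supp u x by [].
    move: Kx => /andP[Kx _]; apply/negP; rewrite -ltNge (lt_le_trans _ Kx)//.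
    by rewrite ltrDl invr_gt0.
  have : {ae leb, forall x, (\bigcap_(U in [set` F]) [set x | U x -> u x = 0]) x}.
    by apply: filter_bigI => U /FU; rewrite inE => -[].
  by apply: filterS => x h /KF[U UF Ux]; exact: (h U).
have := ae_foralln Kae; apply: filterS => x h xrho.
have [k Hk] : exists k : nat, (rho + k.+1%:R^-1 <= `|x|) && (`|x| <= k%:R).
  have d0 : 0 < `|x| - rho by rewrite subr_gt0.
  near \oo => k; exists k; apply/andP; split.
    rewrite addrC -lerBrDr; apply: ltW; near: k.
    exact: near_infty_natSinv_lt (PosNum d0).
  by near: k; exact: nbhs_infty_ger.
exact: h Hk.
Unshelve. all: by end_near. Qed.

Lemma L1loc_measurable u : L1loc u -> measurable_fun setT u.
Proof.
move=> Lu.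
have -> : [set: E] = \bigcup_(k : nat) [set x | `|x| <= k%:R].
  apply/seteqP; split=> // x _; near \oo => k; exists k => //=.
  by near: k; exact: nbhs_infty_ger.
apply/measurable_fun_bigcup => k; first exact: measurable_rV_le.
apply/measurable_EFinP.
have /integrableP[] : leb.-integrable [set x : E | `|x| <= k%:R] (EFin \o u).
  by apply: Lu; exact: compact_rV_le.
by [].
Unshelve. all: by end_near. Qed.

Lemma L1loc_integrable u A : L1loc u ->
  {ae leb, forall x, A < `|x| -> u x = 0} -> leb.-integrable setT (EFin \o u).
Proof.
move=> Lu u0; have mu := L1loc_measurable Lu.
pose B := Num.max A 0.
have mB : measurable [set x : E | `|x| <= B].
  by apply: measurable_rV_le; rewrite le_max lexx orbT.
have /integrableP[_ iB] : leb.-integrable [set x : E | `|x| <= B] (EFin \o u).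
  by apply: Lu; exact: compact_rV_le.
apply/integrableP; split; first exact/measurable_EFinP.
rewrite (_ : integral _ _ _ = \int[leb]_(x in [set x : E | (`|x| <= B)%R]) `|(EFin \o u) x|)%E//.
rewrite [RHS]integral_mkcond; apply: ae_eq_integral => //.
- by apply: measurableT_comp => //; exact/measurable_EFinP.
- apply/(measurable_restrictT _ _).1 => //; apply: measurable_funTS.
  by apply: measurableT_comp => //; exact/measurable_EFinP.
- apply: filterS u0 => x h _; rewrite patchE; case: ifPn => //.
  rewrite notin_setE/= => /negP; rewrite -ltNge gt_max => /andP[/h -> _].
  by rewrite /= normr0.
Qed.

End support.

(** * Duhamel's formula for the mean *)

Lemma ae_eq_Rintegral d (X : measurableType d) (R : realType)
    (m : {measure set X -> \bar R}) (f g : X -> R) :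
  measurable_fun setT f -> measurable_fun setT g ->
  {ae m, forall x, f x = g x} -> \int[m]_x f x = \int[m]_x g x.
Proof.
move=> mf mg fg; congr fine; apply: ae_eq_integral => //.
- exact/measurable_EFinP.
- exact/measurable_EFinP.
- by apply: filterS fg => x /= -> _.
Qed.

Lemma smooth_kernel (R : realType) (b msq : R) (K K1 : R -> R) :
  (forall r : R, is_derive r 1 K (K1 r)) ->
  (forall r : R, is_derive r 1 K1 (- b * K1 r - msq * K r)) -> smooth K.
Proof.
move=> DK DK1 k.
suff [] : Ck k K /\ Ck k K1 by [].
elim: k => [|k [CK CK1]].
  split; split=> // x; apply: differentiable_continuous; apply/derivable1_diffP.
    by have [] := DK x.
  by have [] := DK1 x.
split; first exact: Ck_primitive CK1.
apply: Ck_primitive DK1 _.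
apply: (@CkD _ _ _ (fun r => - b * K1 r) (fun r => - (msq * K r))).
  by apply: CkM => //; exact: Ck_cst.
rewrite (_ : (fun _ => _) = fun r => - msq * K r).
  by apply: CkM => //; exact: Ck_cst.
by apply/funext => r; rewrite mulNr.
Qed.

Section duhamel.
Context (R : realType) (n : nat).
Local Notation E := 'rV[R]_n.
Local Notation leb := (lebesgue_rV R n).
Local Notation lebT := (@lebesgue_measure R).
Context (c H b msq beta p rad eps : R) (Gam : R -> R) (v0 v1 : E -> R).
Context (T : \bar R) (v : R -> E -> R).
Hypotheses (c_gt0 : 0 < c) (H_gt0 : 0 < H) (p_gt1 : 1 < p) (rad_gt0 : 0 < rad).
Hypotheses (v0_loc : L1loc v0) (v1_loc : L1loc v1).
Hypotheses (v0_supp : ess_supp v0 `<=` eucl_ball rad)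
           (v1_supp : ess_supp v1 `<=` eucl_ball rad).
Hypothesis Gam_ge0 : forall s : R, 0 <= s -> 0 <= Gam s.
Hypothesis sol : weak_solution c H b msq beta p Gam rad v0 v1 eps T v.

Let radius (s : R) : R := rad + c * H^-1 * (expR (H * s) - 1).

Let radius_le s t : s <= t -> radius s <= radius t.
Proof.
move=> st; rewrite lerD2l ler_pM2l ?mulr_gt0 ?invr_gt0// lerD2r ler_expR.
by rewrite ler_pM2l.
Qed.

Let radius_gt0 s : 0 <= s -> 0 < radius s.
Proof.
move=> s0; apply: (lt_le_trans rad_gt0); have := radius_le s0.
by rewrite {1}/radius mulr0 expR0 subrr mulr0 addr0.
Qed.

Lemma weak_solution_L1loc s : 0 <= s -> (s%:E < T)%E -> L1loc (v s).
Proof. by case: sol => dv [[Cv _ _] _ _ _] s0 sT; have [] := Cv s _. Qed.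

Lemma weak_solution_ae0 s : 0 < s -> (s%:E < T)%E ->
  {ae leb, forall x, radius s < `|x| -> v s x = 0}.
Proof.
case: sol => dv [_ _ sv _] s0 sT; apply: ess_supp_ae0; last exact: sv.
by apply/ltW/radius_gt0/ltW.
Qed.

(** Testing with s |-> K (t - s) leaves Duhamel's formula for the mean of v.  The
    source integral enters through a lower bound by a constant G on [a, a'], which
    is the form that slicing uses and is available before the measurability of the
    source in time is settled. *)
Lemma duhamel_ge (t a a' G : R) (K K1 : R -> R) :
  0 < t -> (t%:E < T)%E -> 0 < a -> a <= a' -> a' <= t -> 0 <= G ->
  (forall r : R, is_derive r 1 K (K1 r)) ->
  (forall r : R, is_derive r 1 K1 (- b * K1 r - msq * K r)) ->
  K 0 = 0 -> K1 0 = 1 -> (forall r, 0 <= r -> 0 <= K r) ->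
  (forall s : R, a <= s -> s <= a' ->
    (G%:E <= (Gam s)%:E * Lp_mass p (v s) `^ beta *
             (Lp_mass p (v s) * (K (t - s))%:E))%E) ->
  eps * (K t * \int[leb]_x v1 x + (b * K t + K1 t) * \int[leb]_x v0 x)
    + G * (a' - a) <= \int[leb]_x v t x.
Proof.
move=> t0 tT a0 aa' a't G0 DK DK1 K0 K10 Kge0 lowF.
have CK := smooth_kernel DK DK1.
pose g s := K (t - s).
pose g1 s := - K1 (t - s).
pose g2 s := - b * K1 (t - s) - msq * K (t - s).
have Dt (s : R) : is_derive s 1 (fun s : R => t - s) (- 1).
  by have := is_deriveB (is_derive_cst t s 1) (is_derive_id s 1); rewrite sub0r.
have Dg (s : R) : is_derive s 1 g (g1 s).
  rewrite /g1 -mulrN1; exact: (@is_derive1_comp _ K (fun s => t - s)).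
have Dg1 (s : R) : is_derive s 1 g1 (g2 s).
  rewrite (_ : g2 s = - (g2 s * - 1)); last by rewrite mulrN1 opprK.
  apply: is_deriveN; exact: (@is_derive1_comp _ K1 (fun s => t - s)).
have Cg : smooth g.
  move=> k; apply: (@Ck_comp_affine R R R -%R t k K) => //.
    exact: linearP.
  exact: opp_continuous.
have r0 := radius_gt0 (ltW t0).
(* one unit of room, since the Laplacian of phi vanishes inside the open box *)
have A0 : 0 < radius t + 1 by rewrite addr_gt0.
have [phi tphi [psi [psi1 psi0 mpsi [phiE dtE dttE lapE]]]] :=
  exists_test_function n tT A0 Cg Dg Dg1.
case: (sol) => dv [_ _ _ /(_ phi tphi t t0 tT)].
have radt : rad <= radius t.
  by have := radius_le (ltW t0); rewrite {1}/radius mulr0 expR0 subrr mulr0 addr0.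
have aepsi (u : E -> R) (B w : R) : B <= radius t ->
    {ae leb, forall x, B < `|x| -> u x = 0} ->
    {ae leb, forall x, u x * (w * psi x) = u x * w}.
  move=> Bt; apply: filterS => x hu; have [xB|xB] := ltP B `|x|.
    by rewrite hu// !mul0r.
  by rewrite psi1 ?mulr1//; lra.
have intpsi (u : E -> R) (B w : R) : L1loc u -> B <= radius t ->
    {ae leb, forall x, B < `|x| -> u x = 0} ->
    \int[leb]_x (u x * (w * psi x)) = (\int[leb]_x u x) * w.
  move=> Lu Bt u0; have mu := L1loc_measurable Lu.
  rewrite -RintegralZr//; last exact: L1loc_integrable Lu u0.
  apply: ae_eq_Rintegral.
  - by apply: measurable_funM => //; exact: measurable_funM.
  - exact: measurable_funM.
  - exact: aepsi Bt u0.
have vt0 := weak_solution_ae0 t0 tT.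
have vtL := weak_solution_L1loc (ltW t0) tT.
have v00 := ess_supp_ae0 (ltW rad_gt0) v0_supp.
have v10 := ess_supp_ae0 (ltW rad_gt0) v1_supp.
rewrite /weak_identity.
have gt : g t = 0 by rewrite /g subrr.
have -> : \int[leb]_x (dv t x * phi (t, x)) = 0.
  by apply: ae0_Rintegral_nomeas; apply: aeW => x _; rewrite phiE// gt mul0r mulr0.
have -> : \int[leb]_x (v t x * phi (t, x)) = 0.
  by apply: ae0_Rintegral_nomeas; apply: aeW => x _; rewrite phiE// gt mul0r mulr0.
have -> : \int[leb]_x (v t x * dt phi (t, x)) = - \int[leb]_x v t x.
  under eq_Rintegral do rewrite dtE//.
  by rewrite (intpsi _ _ _ vtL (lexx _) vt0) /g1 subrr K10 mulrN1.
have -> : \int[leb]_x (v1 x * phi (0, x)) = (\int[leb]_x v1 x) * K t.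
  under eq_Rintegral do rewrite phiE ?(ltW t0)//.
  by rewrite (intpsi _ _ _ v1_loc radt v10) /g subr0.
have -> : \int[leb]_x (v0 x * (b * phi (0, x) - dt phi (0, x)))
    = (\int[leb]_x v0 x) * (b * K t + K1 t).
  rewrite -(_ : b * g 0 - g1 0 = b * K t + K1 t); last by rewrite /g /g1 subr0 opprK.
  rewrite -(intpsi _ _ _ v0_loc radt v00); apply: eq_Rintegral => x _.
  by rewrite phiE ?dtE ?(ltW t0)// mulrBl mulrA.
rewrite [X in (_ + X)%:E](_ : _ = 0); last first.
  (* the support of v s is known for s > 0 only, hence the null set {0} *)
  apply: ae0_Rintegral_nomeas; exists [set 0]; split => //.
    exact: lebesgue_measure_set1.
  move=> s /= nz; apply: contrapT => s0; apply: nz; rewrite in_itv/= => /andP[s_ge0 st].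
  have s_gt0 : 0 < s by rewrite lt_neqAle s_ge0 andbT eq_sym; apply/eqP.
  have sT : (s%:E < T)%E by apply: le_lt_trans tT; rewrite lee_fin.
  apply: ae0_Rintegral_nomeas.
  have := weak_solution_ae0 s_gt0 sT; apply: filterS => x vs0 _.
  have [xs|xs] := ltP (radius s) `|x|; first by rewrite vs0// mul0r.
  have xt : `|x| < radius t + 1 by have := radius_le st; lra.
  rewrite lapE// dttE// dtE// phiE// mulr0 subr0 /g2 /g1 /g.
  by rewrite (_ : _ - _ + _ = 0) ?mulr0//; ring.
rewrite mulr0 addr0 addr0 sub0r opprK.
set I := (X in _ = (_ + X)%E).
pose hom := eps * (K t * \int[leb]_x v1 x + (b * K t + K1 t) * \int[leb]_x v0 x).
rewrite -/hom.
have -> : eps * ((\int[leb]_x v1 x) * K t) + eps * ((\int[leb]_x v0 x) * (b * K t + K1 t)) = hom.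
  by rewrite /hom; ring.
move=> idt; rewrite -lee_fin idt EFinD leeD2l//.
apply: (@le_trans _ _ (\int[lebT]_(s in `[0%R, t]) ((cst G%:E) \_ `[a, a']) s)%E).
  rewrite -integral_mkcondr setIidr; last first.
    by apply: subset_itvScc => //; exact: ltW.
  by rewrite integral_cst//= lebesgue_measure_itv/= lte_fin; case: ltP => // h;
    rewrite ?EFinB// (_ : a' - a = 0) ?mulr0 ?mule0//; lra.
apply: ge0_le_integral_nomeas => s /=.
  by move=> _; rewrite patchE; case: ifPn.
rewrite in_itv/= => /andP[s0 st].
have Fge0 : (0 <= (Gam s)%:E * Lp_mass p (v s) `^ beta *
          \int[leb]_x (`|v s x| `^ p * phi (s, x))%:E)%E.
  apply: mule_ge0.
    by rewrite mule_ge0// ?poweR_ge0// lee_fin Gam_ge0.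
  apply: integral_ge0 => x _; rewrite lee_fin phiE//.
  by rewrite !mulr_ge0 ?powR_ge0// Kge0// subr_ge0.
rewrite patchE; case: ifPn => //; rewrite inE/= in_itv/= => /andP[as_ sa'].
apply: (le_trans (lowF s as_ sa')); rewrite le_eqVlt; apply/orP; left; apply/eqP.
congr (_ * _)%E.
have s_gt0 : 0 < s by exact: lt_le_trans as_.
have sT : (s%:E < T)%E by apply: le_lt_trans tT; rewrite lee_fin.
have mv := L1loc_measurable (weak_solution_L1loc s0 sT).
have mvp : measurable_fun setT (fun x => `|v s x| `^ p).
  by apply: (measurableT_comp (measurable_powR p)); exact: measurableT_comp.
rewrite /Lp_mass -ge0_integralZr//=.
- apply: ae_eq_integral => //.
  + by apply/measurable_EFinP; exact: measurable_funM.
  + apply/measurable_EFinP.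
    rewrite (_ : (fun x => _) = fun x => `|v s x| `^ p * (g s * psi x)).
      by apply: measurable_funM => //; exact: measurable_funM.
    by apply/funext => x; rewrite phiE.
  + have h : {ae leb, forall x, radius s < `|x| -> `|v s x| `^ p = 0}.
      have := weak_solution_ae0 s_gt0 sT; apply: filterS => x h /h ->.
      by rewrite normr0 powR0// gt_eqF// (lt_trans ltr01).
    have := aepsi _ _ (g s) (radius_le st) h.
    by apply: filterS => x /= e _; rewrite phiE// e.
- exact/measurable_EFinP.
- by rewrite lee_fin Kge0// subr_ge0.
Qed.

End duhamel.

(** * Lower bound for the nonlinear mass *)

Section mass.
Context (R : realType) (n : nat).
Local Notation E := 'rV[R]_n.
Local Notation leb := (lebesgue_rV R n).
Implicit Types (u : E -> R).

Lemma Rintegral_ae_gt0 u (A : R) : L1loc u ->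
  {ae leb, forall x, A < `|x| -> u x = 0} ->
  {ae leb, forall x, 0 <= u x} -> ~ {ae leb, forall x, u x = 0} ->
  0 < \int[leb]_x u x.
Proof.
move=> Lu uA u0 un0.
have mu := L1loc_measurable Lu.
have iu := L1loc_integrable Lu uA.
have uE : (\int[leb]_x (u x)%:E = \int[leb]_x `|(u x)%:E|)%E.
  apply: ae_eq_integral => //.
  - exact/measurable_EFinP.
  - by apply: measurableT_comp => //; exact/measurable_EFinP.
  - by apply: filterS u0 => x ux _; rewrite /= ger0_norm.
have fin : (\int[leb]_x (u x)%:E)%E \is a fin_num by exact: integrable_fin_num.
rewrite lt_neqAle; apply/andP; split; last first.
  by rewrite /Rintegral fine_ge0// uE; apply: integral_ge0.
apply/negP => /eqP iu0; apply: un0.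
have /ae_eq_integral_abs h : (\int[leb]_x `|(u x)%:E| = 0)%E.
  by rewrite -uE -(fineK fin) -/(Rintegral _ _ _) -iu0.
have /h : measurable_fun setT (EFin \o u) by exact/measurable_EFinP.
by move=> /(_ measurableT); apply: filterS => x /(_ I)[].
Qed.

Lemma ler_young (p l x : R) : 1 < p -> 0 < l -> 0 <= x ->
  x <= l `^ (1 - p) * x `^ p + l.
Proof.
move=> p1 l0 x0; have [xl|lx] := leP x l.
  by rewrite ler_wpDl// mulr_ge0// powR_ge0.
rewrite ler_wpDr ?(ltW l0)// -(@mulr_powRB1 _ x p)//; last by lra.
rewrite mulrCA ler_peMr// -opprB powRN ler_pdivlMl ?powR_gt0// mulr1.
by apply: ge0_ler_powR => //; rewrite ?nnegrE ?(ltW l0)// ?(ltW lx)//; lra.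
Qed.

(** Hoelder's inequality on a box, up to the factor 2 ^ - p, from Young's
    inequality with the weight U / (2 V). *)
Lemma Lp_mass_ge u (p B : R) : 1 < p -> 0 < B -> L1loc u ->
  {ae leb, forall x, B < `|x| -> u x = 0} ->
  let U := \int[leb]_x u x in 0 < U ->
  (((U / 2) `^ p * ((2 * B) ^+ n) `^ (1 - p))%:E <= Lp_mass p u)%E.
Proof.
move=> p1 B0 Lu uB U U0.
have mu := L1loc_measurable Lu.
have iu := L1loc_integrable Lu uB.
set V := (2 * B) ^+ n; have V0 : 0 < V by rewrite exprn_gt0// mulr_gt0.
pose l := U / 2 / V; have l0 : 0 < l by rewrite !divr_gt0.
have mup : measurable_fun setT (fun x => `|u x| `^ p).
  by apply: (measurableT_comp (measurable_powR p)); exact: measurableT_comp.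
have mBox : measurable [set x : E | `|x| <= B] by apply: measurable_rV_le; exact: ltW.
have UE : U%:E = (\int[leb]_x (u x)%:E)%E by rewrite fineK//; exact: integrable_fin_num.
have : (U%:E <= (l `^ (1 - p))%:E * Lp_mass p u + (l * V)%:E)%E.
  rewrite UE; apply: (le_trans (lee_abs _)).
  apply: (le_trans (le_abse_integral _ _ _)) => //; first exact/measurable_EFinP.
  rewrite (_ : (l * V)%:E = \int[leb]_x ((cst l%:E \_ [set x : E | (`|x| <= B)%R]) x))%E; last first.
    rewrite -integral_mkcond integral_cst// EFinM; congr (_ * _)%E.
    by apply/esym; exact: lebesgue_rV_le (ltW B0).
  have ml : measurable_fun setT (cst l%:E \_ [set x : E | (`|x| <= B)%R]).
    by apply/(measurable_restrictT _ _).1.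
  have le0 x : (0 <= (cst l%:E \_ [set x : E | (`|x| <= B)%R]) x)%E.
    by rewrite patchE; case: ifPn => // _; rewrite lee_fin ltW.
  rewrite /Lp_mass -ge0_integralZl//; last 2 first.
  - exact/measurable_EFinP.
  - by rewrite lee_fin powR_ge0.
  rewrite -ge0_integralD//=.
  - apply: ae_ge0_le_integral => //.
    + by apply/measurable_EFinP; exact: measurableT_comp.
    + by move=> x _; rewrite adde_ge0// -EFinM lee_fin mulr_ge0// powR_ge0.
    + apply: emeasurable_funD => //.
      by apply: emeasurable_funM => //; exact/measurable_EFinP.
    + apply: filterS uB => x uB _.
      rewrite patchE; case: ifPn => xB.
        by rewrite -EFinM -EFinD lee_fin ler_young.
      move: xB; rewrite notin_setE/= => /negP; rewrite -ltNge => /uB ->.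
      by rewrite /= normr0 adde0 -EFinM lee_fin mulr_ge0// powR_ge0.
  - by move=> x _; rewrite -EFinM lee_fin mulr_ge0// powR_ge0.
  - by apply: emeasurable_funM => //; exact/measurable_EFinP.
have : (0 <= Lp_mass p u)%E by apply: integral_ge0 => x _; rewrite lee_fin powR_ge0.
case: (Lp_mass p u) => [M| |].
- move=> _; rewrite -EFinM -EFinD !lee_fin => h.
  have lV : l * V = U / 2 by rewrite /l divfK// gt_eqF.
  have {h} : U / 2 <= l `^ (1 - p) * M by move: h; rewrite lV; lra.
  rewrite -[1 - p]opprB !powRN ler_pdivlMl ?powR_gt0//.
  apply: le_trans; rewrite ler_pdivrMr ?powR_gt0//.
  have U2 : 0 <= U / 2 by rewrite ltW// divr_gt0.
  rewrite -(@mulr_powRB1 _ (U / 2) p)//; last by lra.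
  rewrite [leRHS]mulrAC [leRHS]mulrC ler_pM2l ?divr_gt0//.
  by rewrite -powRM ?(ltW l0) ?(ltW V0)// lV.
- by move=> _ _; exact: leey.
- by [].
Qed.

End mass.

(** * Blow-up by slicing *)

Section real_lemmas.
Context (R : realType).

Lemma powR_ge_window (sigma x : R) : 1 <= x -> x <= 3 -> 3 `^ (- `|sigma|) <= x `^ sigma.
Proof.
move=> x1 x3; have x0 : 0 <= x by lra.
have [s0|s0] := leP 0 sigma.
  apply: (@le_trans _ _ 1).
    by rewrite powRN invf_le1 ?powR_gt0// -[leLHS](powRr0 (3 : R)) ler_powR//; lra.
  by rewrite -[leLHS](powRr0 x) ler_powR.
rewrite powRN -[sigma in leRHS]opprK powRN (ltr0_norm s0).
rewrite lef_pV2 ?posrE ?powR_gt0//; last by lra.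
by apply: ge0_ler_powR; rewrite ?nnegrE ?oppr_ge0 ?(ltW s0)//; lra.
Qed.

Lemma exists_powR_ge (X e : R) : 0 < e -> exists2 C : R, 1 <= C & X <= C `^ e.
Proof.
move=> e0; have m1 : 1 <= Num.max 1 X by rewrite le_max lexx.
exists (Num.max 1 X `^ e^-1).
  by rewrite -[leLHS](powRr0 (Num.max 1 X)) ler_powR// invr_ge0 ltW.
by rewrite -powRrM mulVf ?gt_eqF// powRr1 ?le_max ?lexx ?orbT// ler01.
Qed.

(** The bound W >= A0 lam ^ j propagates along the windows
    [2 L - L / 2 ^ j, 2 L]: each step loses a factor 4 ^ - j from the two lengths
    t - a' and a' - a, which is absorbed by lam ^ (j (q - 1)) since the power q is
    greater than 1. *)
Lemma slicing_blowup (W : R -> R) (q delta sigma c L A0 lam : R) :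
  1 < q -> 0 <= delta -> 0 < c -> 0 < L -> 0 < A0 -> 2 <= lam -> 4 <= lam `^ (q - 1) ->
  (forall t : R, L <= t -> t <= 2 * L -> A0 <= W t) ->
  (forall A a a' t : R, 0 < A -> L <= a -> a <= a' -> a' <= t -> t <= 2 * L ->
    (forall s : R, a <= s -> s <= a' -> A <= W s) ->
    c * L `^ sigma * A `^ q * ((t - a') / (1 + delta * L)) * (a' - a) <= W t) ->
  16 * lam * (1 + delta * L) <= c * L `^ sigma * L ^+ 2 * A0 `^ (q - 1) ->
  False.
Proof.
move=> q1 d0 c0 L0 A00 lam2 lam4 base step cond.
have lam0 : 0 < lam by lra.
have dL : 0 < 1 + delta * L by rewrite ltr_pwDl// mulr_ge0// ltW.
have H (j : nat) (t : R) : 2 * L - L / 2 ^+ j <= t -> t <= 2 * L -> A0 * lam ^+ j <= W t.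
  elim: j t => [|j IH] t tl tu.
    by rewrite expr0 mulr1; apply: base => //; move: tl; rewrite expr0; lra.
  have P0 : 0 < (2 : R) ^+ j by rewrite exprn_gt0.
  have D1 : L / 2 ^+ j.+1 = L / 2 ^+ j / 2.
    by rewrite exprS invfM mulrA [L / 2]mulrC; ring.
  set h := L / 2 ^+ j in IH D1 tl *.
  have h0 : 0 < h by rewrite divr_gt0.
  have hL : h <= L by rewrite ler_pdivrMr// ler_peMr ?(ltW L0)// exprn_ege1//; lra.
  (* a quarter of the window for the integral, another one for the kernel *)
  pose a := 2 * L - h; pose a' := a + h / 4.
  have tge : a + h / 2 <= t by move: tl; rewrite D1 /a; lra.
  have aL : L <= a by rewrite /a; lra.
  have aa' : a <= a' by rewrite /a'; lra.
  have a't : a' <= t by rewrite /a'; lra.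
  have A0j : 0 < A0 * lam ^+ j by rewrite mulr_gt0// exprn_gt0.
  have Wa (s : R) : a <= s -> s <= a' -> A0 * lam ^+ j <= W s.
    by move=> as_ sa'; apply: IH => //; lra.
  apply: le_trans (step _ a a' t A0j aL aa' a't tu Wa).
  have -> : (A0 * lam ^+ j) `^ q =
      A0 * lam ^+ j * (A0 `^ (q - 1) * (lam `^ (q - 1)) ^+ j).
    rewrite -mulr_powRB1 ?(ltW A0j)//; last by lra.
    rewrite powRM ?(ltW A00) ?exprn_ge0 ?(ltW lam0)//.
    suff -> : (lam ^+ j) `^ (q - 1) = (lam `^ (q - 1)) ^+ j by [].
    by rewrite -(powR_mulrn j (ltW lam0)) powRAC powR_mulrn// powR_ge0.
  have lamj : 4 ^+ j <= (lam `^ (q - 1)) ^+ j by rewrite lerXn2r// ?nnegrE ?powR_ge0.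
  have hh : h ^+ 2 * 4 ^+ j = L ^+ 2.
    rewrite /h expr_div_n -exprM mulnC exprM (_ : 2 ^+ 2 = 4 :> R); last by ring.
    by rewrite divfK// gt_eqF// exprn_gt0.
  apply: (@le_trans _ _ (c * L `^ sigma *
    (A0 * lam ^+ j * (A0 `^ (q - 1) * 4 ^+ j)) * (h / 4 / (1 + delta * L)) * (h / 4))).
    rewrite [leRHS](_ : _ = (c * L `^ sigma * L ^+ 2 * A0 `^ (q - 1)) *
       (A0 * lam ^+ j) / (16 * (1 + delta * L))); last first.
      by rewrite -hh; field; rewrite gt_eqF.
    rewrite ler_pdivlMr ?mulr_gt0//.
    rewrite [leLHS](_ : _ = 16 * lam * (1 + delta * L) * (A0 * lam ^+ j)).
      by rewrite ler_pM2r.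
    by rewrite exprSr; ring.
  have cL : 0 <= c * L `^ sigma by rewrite mulr_ge0 ?powR_ge0 ?(ltW c0).
  have A0q : 0 <= A0 `^ (q - 1) by exact: powR_ge0.
  have Aq4 : 0 <= A0 * lam ^+ j * (A0 `^ (q - 1) * 4 ^+ j).
    by rewrite mulr_ge0 ?(ltW A0j)// mulr_ge0 ?exprn_ge0.
  have hd : 0 <= h / 4 / (1 + delta * L) by rewrite divr_ge0 ?(ltW dL)//; lra.
  apply: ler_pM.
  - by rewrite mulr_ge0// mulr_ge0.
  - by lra.
  - apply: ler_pM.
    + by rewrite mulr_ge0.
    + by [].
    + by rewrite ler_wpM2l// ler_wpM2l ?(ltW A0j)// ler_wpM2l.
    + by rewrite ler_pM2r ?invr_gt0// /a'; lra.
  - by rewrite /a'; lra.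
have [j jW] : exists j : nat, W (2 * L) / A0 < j%:R.
  exists (Num.bound `|W (2 * L) / A0|).
  by rewrite (le_lt_trans (ler_norm _))// archi_boundP.
have := H j (2 * L); rewrite gerBl divr_ge0 ?exprn_ge0 ?(ltW L0)// => /(_ isT (lexx _)).
apply/negP; rewrite -ltNge [A0 * _]mulrC -ltr_pdivrMr// (lt_le_trans jW)//.
apply: (@le_trans _ _ (2 ^+ j)); last by rewrite lerXn2r// ?nnegrE//; lra.
by rewrite -natrX ler_nat ltnW// ltn_expl.
Qed.

End real_lemmas.

(** * Growth of the mean, and the lifespan *)

Section mean_growth.
Context (R : realType) (n : nat).
Local Notation E := 'rV[R]_n.
Local Notation leb := (lebesgue_rV R n).
Context (c H b msq beta p mu sigma rad eps : R) (v0 v1 : E -> R).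
Context (T : \bar R) (v : R -> E -> R).
Let delta := Num.sqrt (b ^+ 2 - 4 * msq).
Let al := 2^-1 * (b - delta).
Let q := (beta + 1) * p.
Let Gam := fun t : R =>
  mu * expR (rho_crit n H b msq beta p * t) * (1 + t) `^ sigma.
Hypotheses (c_gt0 : 0 < c) (H_gt0 : 0 < H) (b_ge0 : 0 <= b) (msq_ge0 : 0 <= msq).
Hypotheses (b_msq : 4 * msq <= b ^+ 2) (beta_ge0 : 0 <= beta) (p_gt1 : 1 < p).
Hypotheses (mu_gt0 : 0 < mu) (rad_gt0 : 0 < rad) (eps_gt0 : 0 < eps).
Hypotheses (v0_loc : L1loc v0) (v1_loc : L1loc v1).
Hypotheses (v0_supp : ess_supp v0 `<=` eucl_ball rad)
           (v1_supp : ess_supp v1 `<=` eucl_ball rad).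
Hypotheses (v0_mean : 0 <= \int[leb]_x v0 x) (v1_mean : 0 <= \int[leb]_x v1 x).
Hypothesis sol : weak_solution c H b msq beta p Gam rad v0 v1 eps T v.

Let W t := expR (al * t) * \int[leb]_x v t x.

(** The factor 3 ^ - |sigma| compares (1 + s) ^ sigma with L ^ sigma on [L, 2 L],
    as 1 <= (1 + s) / L <= 3 when 1 <= L. *)
Definition growth_constant : R :=
  mu * 3 `^ (- `|sigma|) *
  ((2^-1 `^ p * ((2 * (rad + c * H^-1)) ^+ n) `^ (1 - p)) `^ (beta + 1)).

Lemma growth_constant_gt0 : 0 < growth_constant.
Proof.
have k0 : 0 < rad + c * H^-1 by rewrite addr_gt0// mulr_gt0// invr_gt0.
by rewrite /growth_constant !mulr_gt0// powR_gt0// mulr_gt0// powR_gt0// exprn_gt0// mulr_gt0.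
Qed.

Let Gam_ge0 (s : R) : 0 <= s -> 0 <= Gam s.
Proof. by move=> s0; rewrite /Gam !mulr_ge0 ?expR_ge0 ?powR_ge0 ?(ltW mu_gt0). Qed.

(** This is where rho_crit comes from: it compensates the decay exp (- al q s) of
    U ^ q and the loss exp (- n H (p - 1) (beta + 1) s) due to the volume of the
    light cone, up to the factor exp (- al s) that Duhamel's kernel absorbs. *)
Lemma source_ge (A s : R) : 0 < s -> (s%:E < T)%E -> 0 < A -> A <= W s ->
  exists2 m : R, (m%:E <= Lp_mass p (v s))%E & 0 < m /\
    mu * (2^-1 `^ p * ((2 * (rad + c * H^-1)) ^+ n) `^ (1 - p)) `^ (beta + 1)
      * (1 + s) `^ sigma * A `^ q * expR (- al * s)
    = Gam s * m `^ (beta + 1).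
Proof.
move=> s0 sT A0 AW.
set k := rad + c * H^-1; have k0 : 0 < k by rewrite addr_gt0// mulr_gt0// invr_gt0.
pose m := (A * expR (- al * s) / 2) `^ p * ((2 * (k * expR (H * s))) ^+ n) `^ (1 - p).
have As0 : 0 < A * expR (- al * s) by rewrite mulr_gt0// expR_gt0.
have ks0 : 0 < k * expR (H * s) by rewrite mulr_gt0// expR_gt0.
have AU : A * expR (- al * s) <= \int[leb]_x v s x.
  by rewrite mulNr expRN ler_pdivrMr ?expR_gt0// mulrC.
have vL := weak_solution_L1loc sol (ltW s0) sT.
have v_ae := weak_solution_ae0 c_gt0 H_gt0 rad_gt0 sol s0 sT.
have {}v_ae : {ae leb, forall x, k * expR (H * s) < `|x| -> v s x = 0}.
  apply: filterS v_ae => x h hx; apply: h; apply: le_lt_trans hx.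
  have e1 : 1 <= expR (H * s) by rewrite -expR0 ler_expR mulr_ge0// ltW.
  have cH : 0 < c * H^-1 by rewrite mulr_gt0// invr_gt0.
  rewrite -subr_ge0 (_ : _ - _ = rad * (expR (H * s) - 1) + c * H^-1); last first.
    by rewrite /k; ring.
  by rewrite addr_ge0 ?(ltW cH)// mulr_ge0 ?(ltW rad_gt0)// subr_ge0.
exists m; last split.
- apply: le_trans (Lp_mass_ge p_gt1 ks0 vL v_ae (lt_le_trans As0 AU)).
  rewrite lee_fin ler_wpM2r ?powR_ge0//; apply: ge0_ler_powR.
  + exact: ltW (lt_trans ltr01 p_gt1).
  + by rewrite nnegrE divr_ge0// ltW.
  + by rewrite nnegrE divr_ge0// (le_trans (ltW As0)).
  + by rewrite ler_pM2r ?invr_gt0.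
- by rewrite mulr_gt0// powR_gt0// ?divr_gt0// exprn_gt0// mulr_gt0.
- rewrite /m /Gam.
  have -> : (2 * (k * expR (H * s))) ^+ n = (2 * k) ^+ n * expR (n%:R * (H * s)).
    by rewrite expRM_natl mulrA exprMn.
  have k2 : 0 <= (2 * k) ^+ n by rewrite exprn_ge0// mulr_ge0// ltW.
  rewrite !powRM ?mulr_ge0 ?powR_ge0 ?expR_ge0 ?(ltW A0)//.
  rewrite -!expRM -!powRrM.
  have -> : p * (beta + 1) = q by rewrite mulrC.
  rewrite [LHS](_ : _ = (mu * (1 + s) `^ sigma * A `^ q * 2^-1 `^ (q) *
     ((2 * k) ^+ n) `^ ((1 - p) * (beta + 1))) * expR (- al * s)); last by ring.
  rewrite [RHS](_ : _ = (mu * (1 + s) `^ sigma * A `^ q * 2^-1 `^ (q) *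
     ((2 * k) ^+ n) `^ ((1 - p) * (beta + 1))) *
     (expR (rho_crit n H b msq beta p * s) * expR (- al * s * p * (beta + 1)) *
       expR (n%:R * (H * s) * (1 - p) * (beta + 1)))); last by ring.
  rewrite -!expRD; congr (_ * expR _).
  by rewrite /rho_crit -/delta -/al /q; ring.
Qed.

Let kernel : exists K K1 : R -> R,
  [/\ (forall r : R, is_derive r 1 K (K1 r)),
      (forall r : R, is_derive r 1 K1 (- b * K1 r - msq * K r)),
      K 0 = 0 /\ K1 0 = 1,
      (forall r, 0 <= r -> 0 <= K r /\ r / (1 + delta * r) <= expR (al * r) * K r) &
      (forall r, 0 <= r -> 0 <= b * K r + K1 r /\
                           1 <= expR (al * r) * (b * K r + K1 r))].
Proof.
have [K [K1 [DK DK1 K01 Kge homge]]] := damped_kernel b_ge0 msq_ge0 b_msq.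
exists K, K1; split=> // r r0; split; [|exact: Kge| |exact: homge].
  rewrite -(pmulr_rge0 _ (expR_gt0 (al * r))); apply: le_trans (Kge r r0).
  by rewrite divr_ge0// addr_ge0// mulr_ge0// sqrtr_ge0.
by rewrite -(pmulr_rge0 _ (expR_gt0 (al * r))); apply: le_trans (homge r r0).
Qed.

Let Lp_mass_ge0 s : (0 <= Lp_mass p (v s))%E.
Proof. by apply: integral_ge0 => x _; rewrite lee_fin powR_ge0. Qed.

(** Here it is the source term that is dropped. *)
Lemma mean_hom_ge (t : R) : 0 < t -> (t%:E < T)%E ->
  eps * (t / (1 + delta * t) * \int[leb]_x v1 x + \int[leb]_x v0 x) <= W t.
Proof.
move=> t0 tT.
have [K [K1 [DK DK1 [K0 K10] Kge homge]]] := kernel.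
have Kge0 r : 0 <= r -> 0 <= K r by move=> /Kge[].
have := @duhamel_ge R n c H b msq beta p rad eps Gam v0 v1 T v c_gt0 H_gt0 p_gt1 rad_gt0
  v0_loc v1_loc v0_supp v1_supp Gam_ge0 sol t t t 0 K K1 t0 tT t0 (lexx _) (lexx _) (lexx _)
  DK DK1 K0 K10 Kge0.
rewrite mul0r addr0 => h.
have {h} : eps * (K t * \int[leb]_x v1 x + (b * K t + K1 t) * \int[leb]_x v0 x) <= \int[leb]_x v t x.
  apply: h => s ts st; rewrite !mule_ge0 ?poweR_ge0 ?lee_fin ?Gam_ge0 ?Kge0//; lra.
rewrite /W -(ler_pM2l (expR_gt0 (al * t))); apply: le_trans.
rewrite mulrCA ler_pM2l// mulrDr !mulrA lerD//.
  by rewrite ler_wpM2r// (Kge _ (ltW t0)).2.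
by rewrite ler_peMl// (homge _ (ltW t0)).2.
Qed.

(** Only the source term of Duhamel's formula is kept; the kernel is bounded below
    on [a, a'] by its value at the smallest distance t - a'. *)
Lemma mean_step (L A a a' t : R) : 1 <= L -> ((2 * L)%:E < T)%E ->
  0 < A -> L <= a -> a <= a' -> a' <= t -> t <= 2 * L ->
  (forall s : R, a <= s -> s <= a' -> A <= W s) ->
  growth_constant * L `^ sigma * A `^ q * ((t - a') / (1 + delta * L)) * (a' - a) <= W t.
Proof.
move=> L1 LT A0 La aa' a't tL AW.
have d0 : 0 <= delta := sqrtr_ge0 _.
have L0 : 0 < L by lra.
have t0 : 0 < t by lra.
have a0 : 0 < a by lra.
have tT : (t%:E < T)%E by apply: le_lt_trans LT; rewrite lee_fin.
have [K [K1 [DK DK1 [K0 K10] Kge homge]]] := kernel.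
have Kge0 r : 0 <= r -> 0 <= K r by move=> /Kge[].
have dL : 0 < 1 + delta * L by rewrite ltr_pwDl// mulr_ge0// ltW.
pose r := (t - a') / (1 + delta * L).
have r0 : 0 <= r by rewrite divr_ge0 ?(ltW dL)// subr_ge0.
pose G := growth_constant * L `^ sigma * A `^ q * r * expR (- al * t).
have gc0 := growth_constant_gt0.
have G0 : 0 <= G.
  rewrite /G mulr_ge0 ?expR_ge0// mulr_ge0// mulr_ge0 ?powR_ge0//.
  by rewrite mulr_ge0 ?powR_ge0// ltW.
have := @duhamel_ge R n c H b msq beta p rad eps Gam v0 v1 T v c_gt0 H_gt0 p_gt1 rad_gt0
  v0_loc v1_loc v0_supp v1_supp Gam_ge0 sol t a a' G K K1 t0 tT a0 aa' a't G0
  DK DK1 K0 K10 Kge0.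
move=> /(_ _)h; rewrite /W.
have {h} : G * (a' - a) <= \int[leb]_x v t x.
  apply: le_trans (h _); last first.
    move=> s as_ sa'; have s0 : 0 < s by lra.
    have sT : (s%:E < T)%E by apply: le_lt_trans tT; rewrite lee_fin; lra.
    have [m mM [m0 mE]] := source_ge s0 sT A0 (AW s as_ sa').
    have Kr : r * expR (- al * (t - s)) <= K (t - s).
      have ts0 : 0 <= t - s by lra.
      rewrite mulNr expRN ler_pdivrMr ?expR_gt0// [leRHS]mulrC.
      apply: le_trans (Kge _ ts0).2.
      apply: ler_pM => //; first by lra.
        by rewrite invr_ge0 ltW.
        by lra.
      rewrite lef_pV2 ?posrE//; last by rewrite ltr_pwDl// mulr_ge0.
      by rewrite lerD2l ler_wpM2l//; lra.
    have K0s : 0 <= K (t - s) by apply: Kge0; lra.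
    apply: (@le_trans _ _ ((Gam s * m `^ (beta + 1)) * (K (t - s)))%:E).
      rewrite lee_fin -mE.
      have window : 3 `^ (- `|sigma|) * L `^ sigma <= (1 + s) `^ sigma.
        rewrite (_ : 1 + s = (1 + s) / L * L); last by rewrite divfK// gt_eqF.
        rewrite powRM ?(ltW L0)//; last by rewrite divr_ge0 ?(ltW L0)//; lra.
        rewrite ler_wpM2r ?powR_ge0//; apply: powR_ge_window.
          by rewrite ler_pdivlMr//; lra.
        by rewrite ler_pdivrMr//; lra.
      rewrite /G /growth_constant; set c1 := _ `^ (beta + 1).
      have c10 : 0 <= c1 by exact: powR_ge0.
      have -> : expR (- al * t) = expR (- al * s) * expR (- al * (t - s)).
        by rewrite -expRD; congr expR; ring.
      rewrite [leLHS](_ : _ = mu * c1 * (3 `^ (- `|sigma|) * L `^ sigma) * A `^ q *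
        expR (- al * s) * (r * expR (- al * (t - s)))); last by ring.
      have Aq := powR_ge0 A q; have Es := expR_ge0 (- al * s).
      have muc : 0 <= mu * c1 by rewrite mulr_ge0// ltW.
      have win0 : 0 <= 3 `^ (- `|sigma|) * L `^ sigma by rewrite mulr_ge0 ?powR_ge0.
      apply: ler_pM => //.
      - by rewrite mulr_ge0// mulr_ge0// mulr_ge0.
      - by rewrite mulr_ge0// expR_ge0.
      - by rewrite ler_wpM2r// ler_wpM2r// ler_wpM2l.
    have mpos : (0 <= m%:E)%E by rewrite lee_fin ltW.
    have -> : (Gam s * m `^ (beta + 1) * K (t - s))%:E =
        ((Gam s)%:E * m%:E `^ beta * (m%:E * (K (t - s))%:E))%E.
      rewrite poweR_EFin -!EFinM; congr EFin.
      rewrite powRD ?powRr1 ?(ltW m0)//; first by ring.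
      by rewrite (gt_eqF m0) implybT.
    apply: lee_pmul.
    - by rewrite mule_ge0 ?poweR_ge0// lee_fin Gam_ge0// ltW.
    - by rewrite mule_ge0// lee_fin.
    - apply: lee_pmul => //; rewrite ?poweR_ge0 ?lee_fin ?Gam_ge0 ?(ltW s0)//.
      by apply: gt0_ler_poweR => //; rewrite in_itv/= leey andbT.
    - by apply: lee_pmul => //; rewrite lee_fin.
  rewrite lerDr mulr_ge0 ?(ltW eps_gt0)// addr_ge0// mulr_ge0//.
    by apply: Kge0; exact: ltW.
  by have [] := homge _ (ltW t0).
rewrite -(ler_pM2l (expR_gt0 (al * t))); apply: le_trans.
rewrite le_eqVlt; apply/orP; left; apply/eqP; rewrite /G -/r mulNr expRN.
by field; rewrite gt_eqF// expR_gt0.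
Qed.

End mean_growth.

Theorem theorem1p7 (R : realType) (n : nat)
    (c H b msq beta p mu sigma rad : R) (v0 v1 : 'rV[R]_n -> R)
    (n_ge1 : (1 <= n)%N) (c_gt0 : 0 < c) (H_gt0 : 0 < H)
    (b_ge0 : 0 <= b) (msq_ge0 : 0 <= msq) (b_msq : 4 * msq <= b ^+ 2)
    (beta_ge0 : 0 <= beta) (p_gt1 : 1 < p)
    (np : n%:R / 2 - Num.sqrt (b ^+ 2 - 4 * msq) / (2 * H) <= p^-1)
    (mu_gt0 : 0 < mu) (sigma_gt : kappa_crit b msq beta p < sigma)
    (rad_gt0 : 0 < rad)
    (v0_loc : L1loc v0) (v1_loc : L1loc v1)
    (v0_ge0 : {ae lebesgue_rV R n, forall x, 0 <= v0 x})
    (v1_ge0 : {ae lebesgue_rV R n, forall x, 0 <= v1 x})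
    (v0_neq0 : ~ {ae lebesgue_rV R n, forall x, v0 x = 0})
    (v1_neq0 : ~ {ae lebesgue_rV R n, forall x, v1 x = 0})
    (v0_supp : ess_supp v0 `<=` eucl_ball rad)
    (v1_supp : ess_supp v1 `<=` eucl_ball rad) :
  let Gam := fun t : R =>
    mu * expR (rho_crit n H b msq beta p * t) * (1 + t) `^ sigma in
  exists eps0 : R, 0 < eps0 /\
  exists C : R, 0 < C /\
  forall eps : R, 0 < eps -> eps <= eps0 ->
  forall (v : R -> 'rV[R]_n -> R) (T : \bar R),
    has_lifespan c H b msq beta p Gam rad v0 v1 eps v T ->
    (T < +oo)%E /\
    (T <= (C * eps `^ lifespan_exponent b msq beta p sigma)%:E)%E.
Proof.
move=> Gam.
pose delta := Num.sqrt (b ^+ 2 - 4 * msq).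
have d0 : 0 <= delta := sqrtr_ge0 _.
pose q := (beta + 1) * p.
have q1 : 1 < q.
  rewrite -[ltLHS]mul1r /q; apply: (lt_le_trans (y := 1 * p)); first by rewrite !mul1r.
  by rewrite ler_wpM2r ?(ltW (lt_trans ltr01 p_gt1))// lerDr.
have q10 : 0 < q - 1 by rewrite subr_gt0.
set J0 := \int[lebesgue_rV R n]_x v0 x; set J1 := \int[lebesgue_rV R n]_x v1 x.
have v0_ae := ess_supp_ae0 (ltW rad_gt0) v0_supp.
have v1_ae := ess_supp_ae0 (ltW rad_gt0) v1_supp.
have J00 : 0 < J0 by exact: Rintegral_ae_gt0 v0_loc v0_ae v0_ge0 v0_neq0.
have J10 : 0 < J1 by exact: Rintegral_ae_gt0 v1_loc v1_ae v1_ge0 v1_neq0.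
(* the exponent is chosen so that lam ^ (q - 1) = 4 ^ q *)
pose lam : R := 4 `^ ((q - 1)^-1 + 1).
have lam2 : 2 <= lam.
  apply: (@le_trans _ _ (4 `^ 1)); first by rewrite powRr1//; lra.
  by rewrite ler_powR//; [lra|rewrite lerDr invr_ge0 ltW].
have lam0 : 0 < lam by lra.
have lam4 : 4 <= lam `^ (q - 1).
  rewrite -powRrM mulrDl mul1r mulVf ?gt_eqF//.
  rewrite -[leLHS](@powRr1 _ 4); last by lra.
  by rewrite ler_powR; lra.
set g := growth_constant n c H beta p mu sigma rad.
have g0 : 0 < g by exact: growth_constant_gt0.
(* the lifespan is at most 2 L as soon as L is admissible for slicing_blowup *)
have key (eps L A0 : R) (v : R -> 'rV[R]_n -> R) (T : \bar R) :
    0 < eps -> 1 <= L -> 0 < A0 ->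
    (forall t, L <= t -> A0 <= eps * (t / (1 + delta * t) * J1 + J0)) ->
    16 * lam * (1 + delta * L) <= g * L `^ sigma * L ^+ 2 * A0 `^ (q - 1) ->
    has_lifespan c H b msq beta p Gam rad v0 v1 eps v T -> (T <= (2 * L)%:E)%E.
  move=> eps0 L1 A00 Abase cond [_ sol _]; rewrite leNgt; apply/negP => LT.
  have L0 : 0 < L by lra.
  pose W t := expR (2^-1 * (b - delta) * t) * \int[lebesgue_rV R n]_x v t x.
  apply: (@slicing_blowup R W q delta sigma g L A0 lam q1 d0 g0 L0 A00 lam2 lam4 _ _ cond).
    move=> t Lt tL; apply: le_trans (Abase t Lt) _.
    apply: (mean_hom_ge c_gt0 H_gt0 b_ge0 msq_ge0 b_msq p_gt1 mu_gt0 rad_gt0 eps0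
      v0_loc v1_loc v0_supp v1_supp (ltW J00) (ltW J10) sol); first by lra.
    by apply: le_lt_trans LT; rewrite lee_fin.
  move=> A a a' t A1 La aa' a't tL AW.
  exact: (mean_step c_gt0 H_gt0 b_ge0 msq_ge0 b_msq beta_ge0 p_gt1 mu_gt0 rad_gt0 eps0
    v0_loc v1_loc v0_supp v1_supp (ltW J00) (ltW J10) sol L1 LT A1 La aa' a't tL AW).
have fin (eps C e : R) (T : \bar R) : (T <= (2 * (C * eps `^ e))%:E)%E ->
    (T < +oo)%E /\ (T <= (2 * C * eps `^ e)%:E)%E.
  by move=> h; split; [apply: le_lt_trans h _; rewrite ltry|rewrite -mulrA].
have L_ge1 (C eps e : R) : 1 <= C -> 0 < eps -> eps <= 1 -> e <= 0 -> 1 <= C * eps `^ e.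
  move=> C1 e0 e1 ele; apply: mulr_ege1 => //.
  by rewrite -[leLHS](powRr0 eps) ger_powR// e0.
exists 1; split; first by [].
rewrite /lifespan_exponent -/q.
move: sigma_gt; rewrite /kappa_crit -/q; case: ifPn => bm sig.
- have s1 : 0 < sigma + 1 by lra.
  have [C C1 XC] := exists_powR_ge (16 * lam * (1 + delta) / (g * J0 `^ (q - 1))) s1.
  exists (2 * C); split; first by lra.
  move=> eps eps0 eps1 v T life; apply: fin.
  set e := - _; have e0 : e <= 0 by rewrite /e oppr_le0 divr_ge0 ?ltW.
  have L1 := L_ge1 C eps e C1 eps0 eps1 e0; set L := C * _ in L1 *.
  apply: (key eps L (eps * J0) v T) => //.
  + by rewrite mulr_gt0.
  + move=> t Lt; rewrite ler_pM2l// lerDr mulr_ge0 ?(ltW J10)// divr_ge0//; first by lra.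
    by rewrite addr_ge0// mulr_ge0//; lra.
  have L0 : 0 < L by lra.
  have Le : L `^ (sigma + 1) * eps `^ (q - 1) = C `^ (sigma + 1).
    rewrite /L powRM ?powR_ge0//; last by lra.
    rewrite -powRrM -mulrA -powRD; last by rewrite (gt_eqF eps0) implybT.
    rewrite (_ : e * (sigma + 1) + (q - 1) = 0) ?powRr0 ?mulr1//.
    by rewrite /e; field; rewrite gt_eqF.
  rewrite powRM ?(ltW eps0) ?(ltW J00)//.
  have -> : g * L `^ sigma * L ^+ 2 * (eps `^ (q - 1) * J0 `^ (q - 1)) =
      g * J0 `^ (q - 1) * C `^ (sigma + 1) * L.
    rewrite -Le powRD; last by rewrite (gt_eqF L0) implybT.
    by rewrite powRr1 ?(ltW L0)//; ring.
  apply: (@le_trans _ _ (16 * lam * (1 + delta) * L)).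
    by rewrite -[leRHS]mulrA ler_pM2l ?mulr_gt0// mulrDl mul1r lerD2r.
  rewrite ler_pM2r// -ler_pdivrMl; last by rewrite mulr_gt0// powR_gt0.
  by rewrite [leLHS]mulrC.
- have dz : delta = 0.
    rewrite /delta; have -> : b ^+ 2 - 4 * msq = 0 by lra.
    exact: sqrtr0.
  have s1 : 0 < sigma + 1 + q by lra.
  have [C C1 XC] := exists_powR_ge (16 * lam / (g * J1 `^ (q - 1))) s1.
  exists (2 * C); split; first by lra.
  move=> eps eps0 eps1 v T life; apply: fin.
  have eE : ((sigma + 2) / (q - 1) + 1)^-1 = (q - 1) / (sigma + 1 + q).
    by field; rewrite (gt_eqF s1) (gt_eqF q10).
  rewrite eE; set e := - _; have e0 : e <= 0 by rewrite /e oppr_le0 divr_ge0 ?ltW.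
  have L1 := L_ge1 C eps e C1 eps0 eps1 e0; set L := C * _ in L1 *.
  have L0 : 0 < L by lra.
  apply: (key eps L (eps * (L * J1)) v T) => //.
  + by apply: mulr_gt0 => //; exact: mulr_gt0.
  + move=> t Lt; rewrite ler_pM2l// dz mul0r addr0 divr1.
    by rewrite ler_wpDr ?(ltW J00)// ler_pM2r.
  have Le : L `^ (sigma + 1 + q) * eps `^ (q - 1) = C `^ (sigma + 1 + q).
    rewrite /L powRM ?powR_ge0//; last by lra.
    rewrite -powRrM -mulrA -powRD; last by rewrite (gt_eqF eps0) implybT.
    rewrite (_ : e * (sigma + 1 + q) + (q - 1) = 0) ?powRr0 ?mulr1//.
    by rewrite /e; field; rewrite gt_eqF.
  have -> : (eps * (L * J1)) `^ (q - 1) = eps `^ (q - 1) * (L `^ (q - 1) * J1 `^ (q - 1)).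
    by rewrite -(powRM (q - 1) (ltW L0) (ltW J10)) powRM ?(ltW eps0)// mulr_ge0// ltW.
  have -> : g * L `^ sigma * L ^+ 2 * (eps `^ (q - 1) * (L `^ (q - 1) * J1 `^ (q - 1))) =
      g * J1 `^ (q - 1) * C `^ (sigma + 1 + q).
    rewrite -Le (_ : sigma + 1 + q = sigma + 2%:R + (q - 1)); last by ring.
    rewrite powRD; last by rewrite (gt_eqF L0) implybT.
    rewrite powRD; last by rewrite (gt_eqF L0) implybT.
    by rewrite powR_mulrn ?(ltW L0)//; ring.
  rewrite dz mul0r addr0 mulr1 -ler_pdivrMl; last by rewrite mulr_gt0// powR_gt0.
  by rewrite [leLHS]mulrC.
Qed.
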